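(* Let $\bar{\mathcal A}$ be the cluster algebra with principal coefficients at an initial vertex $t_0\in\mathbb{T}_n$, with cluster pattern $t\mapsto(\bar{\mathbf x}_t,\bar{\mathbf y}_t,B_t)$, whose exchange matrices form a pattern of totally sign-skew-symmetric matrices satisfying the Assumption. If $t,t'\in\mathbb{T}_n$ satisfy $C^{t_0}_t=C^{t_0}_{t'}$, then $(\bar{\mathbf x}_t,\bar{\mathbf y}_t,B_t)=(\bar{\mathbf x}_{t'},\bar{\mathbf y}_{t'},B_{t'})$.
   Context: For real $a$, $[a]_+=\max(a,0)$. An integer $n\times n$ matrix $B=(b_{ij})$ is sign-skew-symmetric if $b_{ij}b_{ji}\le0$ and $b_{ij}b_{ji}=0$ implies $b_{ij}=b_{ji}=0$; its mutation at $k$ is $\mu_k(B)=(b'_{ij})$ with $b'_{ij}=-b_{ij}$ if $i=k$ or $j=k$, and $b'_{ij}=b_{ij}+\mathrm{sign}(b_{ik})[b_{ik}b_{kj}]_+$ otherwise; $B$ is totally sign-skew-symmetric if all matrices obtained by finitely many mutations are sign-skew-symmetric. $\mathbb{T}_n$ is the $n$-regular tree with edges labeled $1,\dots,n$, distinct at each vertex. Principal coefficients: the semifield is the tropical semifield $\mathrm{trop}(y_1,\dots,y_n)$ (free abelian group on $y_i$ with $\prod y_i^{a_i}\oplus\prod y_i^{b_i}=\prod y_i^{\min(a_i,b_i)}$), the initial seed at $t_0$ is $(\bar{\mathbf x}_{t_0},(y_1,\dots,y_n),B_{t_0})$, and seeds at other vertices are obtained by seed mutation: $\mu_k(\mathbf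 x,\mathbf y,B)=(\mathbf x',\mathbf y',\mu_k(B))$ with $x'_i=x_i$ ($i\ne k$), $x'_k=\frac{y_k\prod_i x_i^{[b_{ik}]_+}+\prod_i x_i^{[-b_{ik}]_+}}{(y_k\oplus1)x_k}$, $y'_k=y_k^{-1}$, $y'_i=y_iy_k^{[b_{ki}]_+}(y_k\oplus1)^{-b_{ki}}$ ($i\ne k$). Writing $\bar y_{j,t}=\prod_i y_i^{c_{ij,t}}$, the $C$-matrix is $C^{t_0}_t=(c_{ij,t})$. Equivalently, for any exchange matrix pattern $(M_t)$ and vertex $s$, $C$-matrices satisfy $C^s_s=I_n$ and $C^{s}_{t'}=C^{s}_t(J_k+[M_t]_+^{k\cdot})+[-C^{s}_t]_+^{\cdot k}M_t$ along edges $t\overset{k}{\text{---}}t'$ moving away from $s$, where $[A]_+$ is the entrywise positive part, $A^{k\cdot}$ (resp. $A^{\cdot k}$) keeps only the $k$-th row (resp. column), and $J_k$ is the identity with $(k,k)$ entry $-1$. Columns of $C$-matrices are known to be nonzero and sign-coherent; $\varepsilon_k(C)$ is the sign of the $k$-th column. Assumption (for the pattern $(B_t)$): for every $s\in\mathbb{T}_n$ and each $(M_t)\in\{(B_t),(-B_t)\}$, for all $t$ and $k$, $\varepsilon_k$ of the $C$-matrix at $t$ (initial vertex $s$) of $(M_t)$ equals $\varepsilon_k$ of the $C$-matrix at $t$ (initial vertex $s$) of $(-M_t^T)$. *)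

(* Defs.v *)
From mathcomp Require Export all_boot all_order all_algebra.
From mathcomp Require Export mpoly.

Set Implicit Arguments.
Unset Strict Implicit.
Unset Printing Implicit Defensive.

Import Order.TTheory GRing.Theory Num.Theory.
Local Open Scope ring_scope.

Definition posp (a : int) : int := Num.max a 0.

(** * Exchange matrices *)

Definition sign_skew_symmetric n (B : 'M[int]_n) : Prop :=
  forall i j, B i j * B j i <= 0 /\
    (B i j * B j i = 0 -> B i j = 0 /\ B j i = 0).

Definition mu_mx n (k : 'I_n) (B : 'M[int]_n) : 'M[int]_n :=
  \matrix_(i, j)
    if (i == k) || (j == k) then - B i j
    else B i j + Num.sg (B i k) * posp (B i k * B k j).

Definition totally_sign_skew_symmetric n (B : 'M[int]_n) : Prop :=
  forall ks : seq 'I_n, sign_skew_symmetric (foldl (fun M k => mu_mx k M) B ks).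

(** * The n-regular tree
   A vertex is the label word of the geodesic from a root vertex to it, i.e. a
   word without two equal consecutive letters; every such word occurs once.
   The root plays no role in what follows. *)

Definition reduced n (w : seq 'I_n) : bool := sorted (fun i j => i != j) w.

Definition tree n : Type := {w : seq 'I_n | reduced w}.

Definition nbr_word n (k : 'I_n) (w : seq 'I_n) : seq 'I_n :=
  if rev w is j :: w' then (if j == k then rev w' else rcons w k)
  else [:: k].

Lemma nbr_word_reduced n (k : 'I_n) (w : seq 'I_n) :
  reduced w -> reduced (nbr_word k w).
Proof.
rewrite /nbr_word; case/lastP: w => [|w j] //.
rewrite rev_rcons revK; case: eqVneq => [_|jk].
  by rewrite /reduced -cats1 => /cat_sorted2[].
case: w => [|i w] /=; first by rewrite /reduced /= jk.
by rewrite /reduced /= !rcons_path last_rcons jk => /andP[-> ->].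
Qed.

(* The vertex joined to t by the edge labelled k. *)
Definition nbr n (k : 'I_n) (t : tree n) : tree n :=
  exist _ (nbr_word k (sval t)) (nbr_word_reduced k (svalP t)).

Fixpoint geodesic_word n (u v : seq 'I_n) : seq 'I_n :=
  match u, v with
  | i :: u', j :: v' => if i == j then geodesic_word u' v' else rev u ++ v
  | _, _ => rev u ++ v
  end.

(* The labels of the successive edges on the geodesic from s to t. *)
Definition geodesic n (s t : tree n) : seq 'I_n :=
  geodesic_word (sval s) (sval t).

(** * The tropical semifield trop(y_1, ..., y_n)
   The monomial \prod_i y_i ^ a_i is represented by its exponent vector a, so
   that the semifield product, unit and powers are +, 0 and *~. *)

Notation trop n := 'cV[int]_n (only parsing).

Definition oplus n (a b : trop n) : trop n := \col_i Num.min (a i 0) (b i 0).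

Definition trop_gens n : {ffun 'I_n -> trop n} :=
  [ffun j => delta_mx j 0].

Definition mu_coef n (k : 'I_n) (B : 'M[int]_n) (y : {ffun 'I_n -> trop n}) :
    {ffun 'I_n -> trop n} :=
  [ffun i => if i == k then - y k
             else y i + y k *~ posp (B k i) + oplus (y k) 0 *~ (- B k i)].

(* Column j holds the exponents of the j-th coefficient; for a seed pattern with
   principal coefficients at t0, this is the C-matrix with initial vertex t0. *)
Definition coef_mx n (y : {ffun 'I_n -> trop n}) : 'M[int]_n :=
  \matrix_(i, j) y j i 0.

(** * C-matrices of a pattern M of exchange matrices *)

Fixpoint walk_coef n (M : tree n -> 'M[int]_n) (t : tree n)
    (y : {ffun 'I_n -> trop n}) (ks : seq 'I_n) : {ffun 'I_n -> trop n} :=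
  if ks is k :: ks' then walk_coef M (nbr k t) (mu_coef k (M t) y) ks' else y.

(* The C-matrix at t with initial vertex s. *)
Definition C_mx n (M : tree n -> 'M[int]_n) (s t : tree n) : 'M[int]_n :=
  coef_mx (walk_coef M s (trop_gens n) (geodesic s t)).

(* The sign of the k-th column is a partial notion: it is defined when the column
   is nonzero and sign-coherent, as the columns of C-matrices are known to be.
   This says that it is defined and equal to e. *)
Definition col_sign n (C : 'M[int]_n) (k : 'I_n) (e : int) : Prop :=
  [/\ e = 1 \/ e = -1, col k C != 0 & forall i, 0 <= e * C i k].

Definition dual_signs_agree n (M : tree n -> 'M[int]_n) : Prop :=
  forall (s t : tree n) (k : 'I_n), exists e : int,
    col_sign (C_mx M s t) k e /\
    col_sign (C_mx (fun u => - (M u)^T) s t) k e.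

Definition sign_assumption n (B : tree n -> 'M[int]_n) : Prop :=
  dual_signs_agree B /\ dual_signs_agree (fun t => - B t).

(** * Seeds with coefficients in trop(y_1, ..., y_n)
   F is the ambient field and y : 'I_n -> F lists the images in F of the
   generators of the tropical semifield. *)

Record seed (F : fieldType) n := Seed {
  cluster : {ffun 'I_n -> F};
  coeffs : {ffun 'I_n -> trop n};
  exch : 'M[int]_n
}.

Definition trop_eval (F : fieldType) n (y : 'I_n -> F) (a : trop n) : F :=
  \prod_i y i ^ a i 0.

Definition mu_cluster (F : fieldType) n (y : 'I_n -> F) (k : 'I_n)
    (S : seed F n) : {ffun 'I_n -> F} :=
  let x := cluster S in
  let yk := coeffs S k in
  let B := exch S in
  [ffun i => if i == k then
      (trop_eval y yk * (\prod_j x j ^ posp (B j k))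
         + \prod_j x j ^ posp (- B j k))
      / (trop_eval y (oplus yk 0) * x k)
    else x i].

Definition mu_seed (F : fieldType) n (y : 'I_n -> F) (k : 'I_n)
    (S : seed F n) : seed F n :=
  Seed (mu_cluster y k S) (mu_coef k (exch S) (coeffs S)) (mu_mx k (exch S)).

Definition cluster_pattern (F : fieldType) n (y : 'I_n -> F)
    (S : tree n -> seed F n) : Prop :=
  forall (t : tree n) (k : 'I_n), S (nbr k t) = mu_seed y k (S t).

(* F = Q(z_1, ..., z_m) with z_1, ..., z_m algebraically independent; the first
   clause forces characteristic 0, and denominators can be cleared, so integer
   coefficients suffice. *)
Definition free_generators (F : fieldType) m (z : 'I_m -> F) : Prop :=
  (forall p : {mpoly int[m]}, mmap intr z p = 0 -> p = 0) /\
  (forall f : F, exists p q : {mpoly int[m]},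
     mmap intr z q != 0 /\ f = mmap intr z p / mmap intr z q).

Definition join_vars (F : fieldType) n (x y : 'I_n -> F) (i : 'I_(n + n)) : F :=
  match split i with inl j => x j | inr j => y j end.

Definition principal_coefficients (F : fieldType) n (y : 'I_n -> F)
    (t0 : tree n) (S : tree n -> seed F n) : Prop :=
  [/\ cluster_pattern y S,
      coeffs (S t0) = trop_gens n
    & free_generators (join_vars (cluster (S t0)) y)].

(* Main.v *)
Require Import Defs.
From mathcomp Require Import zify ring.
From Stdlib Require Import FunctionalExtensionality.

Set Implicit Arguments.
Unset Strict Implicit.
Unset Printing Implicit Defensive.

Import Order.TTheory GRing.Theory Num.Theory.
Local Open Scope ring_scope.

(**
   Sign agreement of the patterns B and -B^T gives the dualities of C-matrices
   (inverses, change of the initial vertex), so that C_t = C_t' propagates to all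
   initial vertices and to the pattern -B^T; this already yields B_t = B_t'.

   For the clusters, let L = x_{i;t'} / x_{i;t}. By the Laurent phenomenon L is a
   Laurent polynomial in (x_t, y) and 1/L one in (x_t', y). All cluster variables
   are subtraction-free in each other, hence have a value under every max-plus
   weight, without cancellation. Weights making all y-hat at t0 negative give
   x_{i;t} and x_{i;t'} the same value (the C-matrices of -B^T are inverse
   transposes of the G-matrices); a generic such weight shows that the constant
   term of L is nonzero. So every weight is nonnegative on L and, symmetrically,
   on 1/L; hence L is a constant, and this constant is 1.
*)

(** * Walks in the tree *)

(** A totally sign-skew-symmetric matrix need not have a skew-symmetrizer, the usual source of the
    dualities. Its substitute is the equality of column signs for [B] and [-B^T]: along an edge both
    C-matrices are multiplied by elementary matrices of the same sign, which keeps [B_t] congruent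
    to [B_s] through the pair. Freeness is given only at [t0]; elsewhere even [x_t != 0] has to be
    proved. Both nonvanishing and independence of [(x_t, y)] are read off from weights that separate
    finitely many exponents. Such weights exist with all y-hat negative because principal
    coefficients leave the weights of the [y_i] free. In the Laurent phenomenon, coprimality is
    expressed by non-zero-divisors modulo one exchange polynomial. A grading by a row of the inverse
    C-matrix, which gives one y-hat degree 0 and another degree 1 or -1, detects them. At the end
    the ratio and its inverse are both integers, so the ratio is 1 or -1; it cannot be -1 since 1
    plus the ratio is subtraction-free, hence nonzero. *)

Section Tree.
Variable n : nat.
Implicit Types (w u v p : seq 'I_n) (s t : tree n) (k : 'I_n).

Lemma nbr_word_rcons k w j :
  nbr_word k (rcons w j) = if j == k then w else rcons (rcons w j) k.
Proof. by rewrite /nbr_word rev_rcons revK. Qed.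

Lemma nbr_word_reduced_rcons k w :
  reduced (rcons w k) -> nbr_word k w = rcons w k.
Proof.
case/lastP: w => [//|w j]; rewrite nbr_word_rcons; case: eqP => // ->.
by rewrite /reduced -!cats1 -catA => /cat_sorted2[_] /=; rewrite eqxx.
Qed.

Lemma nbrK k : involutive (@nbr n k).
Proof.
move=> t; apply: val_inj => /=; case: t => w /=.
case/lastP: w => [|w j] red; first by rewrite (nbr_word_rcons k [::] k) eqxx.
rewrite nbr_word_rcons; case: eqP => [<-|/eqP jk].
  exact: nbr_word_reduced_rcons.
by rewrite nbr_word_rcons eqxx.
Qed.

Definition walk t (ks : seq 'I_n) : tree n := foldl (fun t k => nbr k t) t ks.

Lemma walk_cat t ks ls : walk t (ks ++ ls) = walk (walk t ks) ls.
Proof. exact: foldl_cat. Qed.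

Lemma walk_rev t ks : walk (walk t ks) (rev ks) = t.
Proof.
elim: ks t => //= k ks IH t.
by rewrite rev_cons -cats1 walk_cat IH /= nbrK.
Qed.

Lemma sval_walk t ks : sval (walk t ks) = foldl (fun w k => nbr_word k w) (sval t) ks.
Proof. by elim: ks t => //= k ks IH t; rewrite IH. Qed.

Lemma reducedW u v : reduced (u ++ v) -> reduced u.
Proof. by case/cat_sorted2. Qed.

Lemma walk_word_cat p v :
  reduced (p ++ v) -> foldl (fun w k => nbr_word k w) p v = p ++ v.
Proof.
elim: v p => [|k v IH] p /=; first by rewrite cats0.
rewrite -cat_rcons => red; rewrite nbr_word_reduced_rcons ?IH //.
exact: reducedW red.
Qed.

Lemma walk_word_rev p u :
  foldl (fun w k => nbr_word k w) (p ++ u) (rev u) = p.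
Proof.
elim/last_ind: u => [|u k IH]; first by rewrite cats0.
by rewrite rev_rcons -rcons_cat /= nbr_word_rcons eqxx.
Qed.

(** The prefix [p] is what [geodesic_word] has already stripped from both words. Where the words
    diverge, the path climbs along [rev u] to [p] and descends along [v]. *)
Lemma geodesic_wordP p u v : reduced (p ++ v) ->
  foldl (fun w k => nbr_word k w) (p ++ u) (geodesic_word u v) = p ++ v.
Proof.
elim: u v p => [|i u IH] [|j v] p red /=.
- by [].
- by rewrite cats0; exact: (@walk_word_cat p (j :: v) red).
- by rewrite !cats0 walk_word_rev.
case: eqP red => [->|_] red.
  by rewrite -!cat_rcons; apply: IH; rewrite cat_rcons.
by rewrite foldl_cat walk_word_rev walk_word_cat.
Qed.

Lemma walk_geodesic s t : walk s (geodesic s t) = t.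
Proof.
apply: val_inj; rewrite -[LHS]/(sval _) sval_walk.
exact: (@geodesic_wordP [::] _ _ (svalP t)).
Qed.

Lemma tree_walk_ind s (Q : tree n -> Prop) :
  Q s -> (forall t k, Q t -> Q (nbr k t)) -> forall t, Q t.
Proof.
move=> Qs QN t; rewrite -(walk_geodesic s t).
move: (geodesic s t) => ks; elim: ks s Qs => //= k ks IH s Qs.
exact/IH/QN.
Qed.

Lemma walk_root t : walk (exist _ [::] isT) (sval t) = t.
Proof.
by apply: val_inj; rewrite -[LHS]/(sval _) sval_walk walk_word_cat // (svalP t).
Qed.

End Tree.

(** * Mutation of coefficients *)

Section Coefficients.
Variable n : nat.
Implicit Types (s t u : tree n) (k : 'I_n) (M : tree n -> 'M[int]_n).
Implicit Types (A B C : 'M[int]_n) (y : {ffun 'I_n -> trop n}).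

Definition exchange_pattern M := forall t k, M (nbr k t) = mu_mx k (M t).

Lemma posp_sub a : posp a - posp (- a) = a.
Proof. rewrite /posp; lia. Qed.

Lemma mu_mx_row k B j : mu_mx k B k j = - B k j.
Proof. by rewrite mxE eqxx. Qed.

Lemma mu_mx_col k B i : mu_mx k B i k = - B i k.
Proof. by rewrite mxE eqxx orbT. Qed.

Lemma mu_coefE k B y i a :
  mu_coef k B y i a 0 = if i == k then - y k a 0
    else y i a 0 + y k a 0 * posp (B k i) - Num.min (y k a 0) 0 * B k i.
Proof.
rewrite !ffunE; case: eqP => _; rewrite ?mxE // -!scaler_int !mxE !intz.
by rewrite mulNr (mulrC (posp _)) (mulrC (B k i)).
Qed.

(** Only row [k] of the exchange matrix enters [mu_coef]. The cancellation rests on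
    [min(-c, 0) = min(c, 0) - c]. *)
Lemma mu_coefK k B B' y : (forall j, B' k j = - B k j) ->
  mu_coef k B' (mu_coef k B y) = y.
Proof.
move=> B'E; apply/ffunP => i; apply/matrixP => a b; rewrite ord1 {b} mu_coefE B'E.
rewrite !(mu_coefE k B) eqxx; case: eqP => [->|_]; first by rewrite opprK.
have -> : posp (- B k i) = posp (B k i) - B k i by rewrite -{3}[B k i]posp_sub subKr.
have -> : Num.min (- y k a 0) 0 = Num.min (y k a 0) 0 - y k a 0 by lia.
ring.
Qed.

(** Turns the path-dependent [walk_coef] into a function of the vertex. From the root, a vertex is
    reached by its reduced word; any other [s] is handled edge by edge, undoing a mutation by
    [mu_coefK]. *)
Lemma mutation_extension M s y : exchange_pattern M ->
  exists Y : tree n -> {ffun 'I_n -> trop n},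
    Y s = y /\ forall t k, Y (nbr k t) = mu_coef k (M t) (Y t).
Proof.
move=> patM; pose r : tree n := exist _ [::] isT.
have walk_coef_rcons t0 z ks k :
    walk_coef M t0 z (rcons ks k) = mu_coef k (M (walk t0 ks)) (walk_coef M t0 z ks).
  by elim: ks t0 z => //= j ks IH t0 z; rewrite IH.
have patK t k j : M (nbr k t) k j = - M t k j by rewrite patM mu_mx_row.
move: s y; apply: (@tree_walk_ind n r) => [y|s k IH y].
  exists (fun t => walk_coef M r y (sval t)); split=> // t k /=.
  case/lastP w_t: (sval t) => [|w j]; first by rewrite -(walk_root t) w_t.
  rewrite nbr_word_rcons; case: eqP => [jk|_]; last first.
    by rewrite [LHS]walk_coef_rcons -w_t walk_root.
  rewrite walk_coef_rcons jk mu_coefK // => i.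
  by rewrite -{1}(walk_root t) w_t -cats1 walk_cat jk /= patK.
have [Y [Ys YN]] := IH (mu_coef k (M (nbr k s)) y); exists Y; split=> //.
by rewrite YN Ys mu_coefK // => j; rewrite patK opprK.
Qed.

Lemma walk_coef_eq M (Y : tree n -> {ffun 'I_n -> trop n}) s ks :
  (forall t k, Y (nbr k t) = mu_coef k (M t) (Y t)) ->
  walk_coef M s (Y s) ks = Y (walk s ks).
Proof. by move=> YN; elim: ks s => //= k ks IH s; rewrite -YN IH. Qed.

Lemma C_mxE M (Y : tree n -> {ffun 'I_n -> trop n}) s t :
  (forall t k, Y (nbr k t) = mu_coef k (M t) (Y t)) -> Y s = trop_gens n ->
  C_mx M s t = coef_mx (Y t).
Proof. by move=> YN Ys; rewrite /C_mx -Ys walk_coef_eq // walk_geodesic. Qed.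

Lemma C_mx_id M s : C_mx M s s = 1%:M.
Proof.
rewrite /C_mx /geodesic.
have -> : geodesic_word (sval s) (sval s) = [::].
  by elim: (sval s) => //= i w; rewrite eqxx.
by apply/matrixP => i j; rewrite !mxE ffunE mxE eqxx andbT.
Qed.

(* The matrix J_k + [e B]_+^{k.} of the column-sign form of C-matrix mutation;
   the diagonal entry of B plays no role. *)
Definition elem_mx k (e : int) B : 'M[int]_n :=
  \matrix_(i, j) if i == k then (if j == k then -1 else posp (e * B k j))
                 else (i == j)%:R.

(** A total stand-in for [col_sign]: every column that is not nonnegative gets -1, so the value is
    meaningful only together with [sign_coherent]. *)
Definition csgn C k : int := if [forall i, 0 <= C i k] then 1 else -1.

Lemma col_sign_csgn C k e : col_sign C k e -> e = csgn C k.
Proof.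
case=> ee nz ge0; rewrite /csgn; case: forallP => [C_ge0|].
  case: ee => // eN; case/eqP: nz; apply/matrixP => i j; rewrite !mxE.
  by have := ge0 i; have := C_ge0 i; rewrite eN; lia.
by case: ee => // e1; case=> i; have := ge0 i; rewrite e1 mul1r.
Qed.

Definition sign_coherent C := forall k, col k C != 0 /\ forall i, 0 <= csgn C k * C i k.

Lemma csgn_cases C k : csgn C k = 1 \/ csgn C k = -1.
Proof. by rewrite /csgn; case: ifP; [left|right]. Qed.

Lemma mul_elem_mxl m k e B (C : 'M[int]_(n, m)) i j :
  (elem_mx k e B *m C) i j = if i == k then
     - C k j + \sum_(l | l != k) posp (e * B k l) * C l j else C i j.
Proof.
rewrite !mxE; case: eqP => [->|/eqP ik].
  rewrite (bigD1 k) //= !mxE eqxx mulN1r; congr (_ + _).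
  by apply: eq_bigr => l lk; rewrite !mxE eqxx (negPf lk).
rewrite (bigD1 i) //= big1 => [|l li].
  by rewrite !mxE (negPf ik) eqxx mul1r addr0.
by rewrite !mxE (negPf ik) eq_sym (negPf li) mul0r.
Qed.

Lemma mul_elem_mxr k e B C i j :
  (C *m elem_mx k e B) i j =
    if j == k then - C i k else C i j + C i k * posp (e * B k j).
Proof.
rewrite !mxE (bigD1 k) //= !mxE eqxx; case: eqP => [jk|/eqP jk].
  rewrite mulrN1 big1 ?addr0 // => l lk.
  by rewrite !mxE (negPf lk) jk (negPf lk) mulr0.
rewrite addrC (bigD1 j) //= big1 => [|l /andP[lk lj]].
  by rewrite !mxE (negPf jk) eqxx mulr1 addr0.
by rewrite !mxE (negPf lk) (negPf lj) mulr0.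
Qed.

Lemma elem_mxK k e B : elem_mx k e B *m elem_mx k e B = 1%:M.
Proof.
apply/matrixP => i j; rewrite mul_elem_mxr !mxE; case: (eqVneq i k) => [->|ik].
  by case: (eqVneq j k) => jk; rewrite eqxx /= ?opprK // mulN1r subrr.
by case: (eqVneq j k) => [->|jk]; rewrite ?(negPf ik) ?oppr0 // mul0r addr0.
Qed.

Lemma elem_mxM k e B B' : (forall j, B' k j = - B k j) ->
  elem_mx k e B' = elem_mx k (- e) B.
Proof. by move=> B'E; apply/matrixP => i j; rewrite !mxE B'E mulNr mulrN. Qed.

Lemma elem_mxN k e B : elem_mx k e (- B) = elem_mx k (- e) B.
Proof. by apply: elem_mxM => j; rewrite mxE. Qed.

(** In a sign-coherent column [min(c, 0)] is 0 throughout or [c] throughout, which makes the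
    tropical rule linear. *)
Lemma C_mx_nbr M s t k : exchange_pattern M -> sign_coherent (C_mx M s t) ->
  C_mx M s (nbr k t) = C_mx M s t *m elem_mx k (csgn (C_mx M s t) k) (M t).
Proof.
move=> patM sgn; have [Y [Ys YN]] := mutation_extension s (trop_gens n) patM.
have [_ {sgn}] := sgn k; have := csgn_cases (C_mx M s t) k.
move: (csgn _ _) => e; rewrite !(C_mxE _ YN Ys) YN => ee ge0.
apply/matrixP => i j; rewrite mul_elem_mxr mxE mu_coefE; case: eqP => [_|_].
  by rewrite !mxE.
move: (ge0 i); rewrite !mxE; case: ee => ->; rewrite ?mul1r ?mulN1r => ci.
  have -> : Num.min (Y t k i 0) 0 = 0 by lia.
  by rewrite mul0r subr0.
have -> : Num.min (Y t k i 0) 0 = Y t k i 0 by lia.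
by rewrite -[X in _ - _ * X]posp_sub mulrBr; ring.
Qed.

(* Both signs are allowed: the two correction terms differ by the vanishing
   [b_ik b_kj - b_ik b_kj]. *)
Lemma mu_mx_elem k B e : B k k = 0 -> e = 1 \/ e = -1 ->
  mu_mx k B = (elem_mx k e (- B^T))^T *m B *m elem_mx k e B.
Proof.
move=> Bkk ee; apply/matrixP => i j; rewrite mul_elem_mxr.
have mulL l : ((elem_mx k e (- B^T))^T *m B) i l =
    if i == k then - B k l else B i l + posp (- (e * B i k)) * B k l.
  rewrite -[_ *m B]trmxK trmx_mul trmxK mxE mul_elem_mxr !mxE.
  by case: eqP => // _; rewrite mulrN (mulrC (posp _)).
rewrite !mulL mxE; case: (eqVneq i k) => [->|ik] /=.
  by rewrite Bkk !oppr0 mul0r addr0; case: eqP => // ->; rewrite Bkk oppr0.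
case: (eqVneq j k) => [->|jk]; first by rewrite Bkk mulr0 addr0.
rewrite Bkk mulr0 addr0 -!addrA; congr (_ + _).
by case: ee => ->; rewrite ?mul1r ?mulN1r ?opprK /posp; case: (sgrP (B i k)); nia.
Qed.

Lemma mu_mx_opp k B : mu_mx k (- B) = - mu_mx k B.
Proof.
apply/matrixP => i j; rewrite !mxE; case: ifP => // _.
by rewrite sgrN mulrNN mulNr opprD.
Qed.

Lemma mu_mx_tr k B : mu_mx k B^T = (mu_mx k B)^T.
Proof.
apply/matrixP => i j; rewrite !mxE orbC; case: ifP => // _; congr (_ + _).
rewrite (mulrC (B k i)) /posp.
by case: (sgrP (B j k)); case: (sgrP (B k i)); nia.
Qed.

End Coefficients.

(** * Dualities of C-matrices *)

Section Duality.
Variable n : nat.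
Implicit Types (s t u : tree n) (k l : 'I_n) (M : tree n -> 'M[int]_n).

Definition opp_pattern M t := - M t.
Definition dual_pattern M t := - (M t)^T.

Lemma opp_patternK : involutive opp_pattern.
Proof.
by move=> M; apply: functional_extensionality => t; rewrite /opp_pattern opprK.
Qed.

Lemma dual_patternK : involutive dual_pattern.
Proof.
move=> M; apply: functional_extensionality => t.
by rewrite /dual_pattern linearN /= trmxK opprK.
Qed.

Lemma dual_opp_pattern M : dual_pattern (opp_pattern M) = opp_pattern (dual_pattern M).
Proof.
by apply: functional_extensionality => t; rewrite /dual_pattern /opp_pattern linearN.
Qed.

Definition dual_coherent M := forall s t,
  [/\ sign_coherent (C_mx M s t), sign_coherent (C_mx (dual_pattern M) s t)
    & forall k, csgn (C_mx (dual_pattern M) s t) k = csgn (C_mx M s t) k].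

(** These conditions pass to [opp_pattern M] and [dual_pattern M]; the induction on the walk applies
    its hypothesis to all three patterns. *)
Record coherent_pattern M : Prop := CoherentPattern {
  coherent_exchange : exchange_pattern M;
  coherent_diag : forall t k, M t k k = 0;
  coherent_dual : dual_coherent M;
  coherent_opp_dual : dual_coherent (opp_pattern M)
}.

Lemma dual_coherentP M : dual_signs_agree M -> dual_coherent M.
Proof.
move=> agr s t; rewrite /sign_coherent; split=> k; have [e []] := agr s t k;
  rewrite -/(dual_pattern M) => h1 h2.
- by rewrite -(col_sign_csgn h1); case: h1.
- by rewrite -(col_sign_csgn h2); case: h2.
by rewrite -(col_sign_csgn h1) -(col_sign_csgn h2).
Qed.

Lemma dual_coherent_dual M : dual_coherent M -> dual_coherent (dual_pattern M).
Proof. by move=> coh s t; rewrite dual_patternK; have [? ? eq_s] := coh s t; split=> // k; rewrite eq_s. Qed.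

Lemma coherent_opp M : coherent_pattern M -> coherent_pattern (opp_pattern M).
Proof.
case=> pat diag dual odual; split=> //; last by rewrite opp_patternK.
  by move=> t k; rewrite /opp_pattern pat mu_mx_opp.
by move=> t k; rewrite /opp_pattern mxE diag oppr0.
Qed.

Lemma coherent_dual_pattern M : coherent_pattern M -> coherent_pattern (dual_pattern M).
Proof.
case=> pat diag dual odual; split.
- by move=> t k; rewrite /dual_pattern pat mu_mx_opp mu_mx_tr.
- by move=> t k; rewrite /dual_pattern !mxE diag oppr0.
- exact: dual_coherent_dual.
by rewrite -dual_opp_pattern; apply: dual_coherent_dual.
Qed.

Lemma coherent_signs M s t : coherent_pattern M -> sign_coherent (C_mx M s t).
Proof. by case=> _ _ coh _; have [] := coh s t. Qed.

Lemma csgn_dual M s t k : coherent_pattern M ->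
  csgn (C_mx (dual_pattern M) s t) k = csgn (C_mx M s t) k.
Proof. by case=> _ _ coh _; have [_ _] := coh s t; apply. Qed.

Lemma coherent_nbr M s t k : coherent_pattern M ->
  C_mx M s (nbr k t) = C_mx M s t *m elem_mx k (csgn (C_mx M s t) k) (M t).
Proof. by move=> coh; apply: C_mx_nbr (coherent_signs _ _ coh); case: coh. Qed.

(** Sign agreement makes the factor gained by the dual C-matrix the left factor of [mu_mx_elem] for
    the very sign used on the right, so each edge appends one congruence. *)
Lemma exchange_C_mx M s t : coherent_pattern M ->
  M t = (C_mx (dual_pattern M) s t)^T *m M s *m C_mx M s t.
Proof.
move=> coh; have cohD := coherent_dual_pattern coh.
move: t; apply: (tree_walk_ind (s := s)) => [|t k IH].
  by rewrite !C_mx_id trmx1 mul1mx mulmx1.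
rewrite !coherent_nbr // csgn_dual // (coherent_exchange coh).
rewrite (mu_mx_elem (coherent_diag coh t k) (csgn_cases (C_mx M s t) k)).
by rewrite {2}IH trmx_mul !mulmxA.
Qed.

(** * Inversion of C-matrices and change of the initial vertex *)

Lemma csgn1 k : csgn (1%:M : 'M_n) k = 1.
Proof. by rewrite /csgn ifT //; apply/forallP => i; rewrite mxE ler0n. Qed.

(** By [C_mxV] below, this is the sign of column [k] of the inverse of [C_mx M s t]. *)
Definition shift_sign M s t k := csgn (C_mx (opp_pattern M) t s) k.

Definition initial_shift M s t := forall k,
  C_mx M (nbr k s) t = elem_mx k (- shift_sign M s t k) (M s) *m C_mx M s t.

Lemma shift_sign_dual M s t k : coherent_pattern M ->
  shift_sign (dual_pattern M) s t k = shift_sign M s t k.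
Proof.
by move=> coh; rewrite /shift_sign -dual_opp_pattern csgn_dual //; apply: coherent_opp.
Qed.

(** Off row [k] the entries are both nonnegative and nonpositive. As a move of the initial vertex
    along [k] alters row [k] only, a sign flip under it pins the column down to a multiple of a
    basis vector. *)
Lemma csgn_eq_off k l (C C' : 'M[int]_n) : sign_coherent C -> sign_coherent C' ->
  (forall i, i != k -> C' i l = C i l) -> csgn C' l != csgn C l ->
  forall i, i != k -> C i l = 0.
Proof.
move=> /(_ l)[_ cohC] /(_ l)[_ cohC'] eqC neq i ik.
have := cohC i; have := cohC' i; rewrite eqC //; move: neq.
by case: (csgn_cases C l) => ->; case: (csgn_cases C' l) => ->; rewrite ?eqxx //; lia.
Qed.

Lemma unimodular_col (C D : 'M[int]_n) k l : C *m D = 1%:M ->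
  sign_coherent C -> (forall i, i != k -> C i l = 0) -> C k l = csgn C l.
Proof.
move=> CD coh Cl0; have DC := mulmx1C CD.
have Dl : D l k * C k l = 1.
  have := congr1 (fun A : 'M_n => A l l) DC; rewrite !mxE eqxx (bigD1 k) //=.
  by rewrite big1 ?addr0 // => i ik; rewrite Cl0 ?mulr0.
have [_ /(_ k)] := coh l; move: Dl (csgn_cases C l).
move: (D l k) (C k l) (csgn C l) => a b c ab.
have /orP[] : (b == 1) || (b == -1) := intUnitRing.unitzPl ab;
  by move/eqP=> -> [] ->; lia.
Qed.

Lemma unimodular_col_inv (C D : 'M[int]_n) k l e i : C *m D = 1%:M ->
  e = 1 \/ e = -1 -> (forall j, D j k = e * (j == l)%:R) ->
  C i l = e * (i == k)%:R.
Proof.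
move=> CD ee Dk; have := congr1 (fun A : 'M_n => A i k) CD.
rewrite !mxE (bigD1 l) //= Dk eqxx mulr1.
rewrite big1 ?addr0 => [<-|j jl]; last by rewrite Dk (negPf jl) !mulr0.
by case: ee => ->; ring.
Qed.

Lemma sign_eq (a b : int) :
  a = 1 \/ a = -1 -> b = 1 \/ b = -1 -> 0 <= a * b -> a = b.
Proof. by case=> ->; case=> ->. Qed.

(** By [[a]_+ - [-a]_+ = a] the positive parts recombine into row [k] of [B], leaving an expression
    linear in [B]. *)
Lemma elem_mx_sq k e (B : 'M[int]_n) : B k k = 0 -> e = 1 \/ e = -1 ->
  elem_mx k e B *m elem_mx k (- e) B = 1%:M + e *: (delta_mx k k *m B).
Proof.
move=> Bkk ee; apply/matrixP => i j; rewrite mul_elem_mxr !mxE.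
rewrite (bigD1 k) //= big1 ?addr0; last first.
  by move=> l lk; rewrite !mxE (negPf lk) andbF mul0r.
rewrite !mxE !eqxx andbT; case: (eqVneq i k) => [->|ik].
  case: (eqVneq j k) => [->|jk]; first by rewrite /= Bkk !mulr0 addr0 opprK.
  rewrite /= mul1r add0r mulN1r mulNr; exact: posp_sub.
by case: (eqVneq j k) => [->|jk]; rewrite /= ?(negPf ik) !(mul0r, mulr0, addr0, oppr0).
Qed.

(** The two claims feed each other: the inverse for a longer walk comes from the shift rule of
    [opp_pattern M] along the reversed walk. *)
Lemma C_mx_shift M d : coherent_pattern M -> forall ks s, size ks = d ->
  let t := walk s ks in
  C_mx M s t *m C_mx (opp_pattern M) t s = 1%:M /\ initial_shift M s t.
Proof.
elim/ltn_ind: d M => d IH M coh ks s szks /=.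
case/lastP: ks szks => [|ks l] szks /=.
  split=> [|k]; first by rewrite !C_mx_id mulmx1.
  rewrite /shift_sign !C_mx_id csgn1 mulmx1 -{2}(nbrK k s) coherent_nbr //.
  rewrite !C_mx_id csgn1 mul1mx; apply: elem_mxM => j.
  by rewrite (coherent_exchange coh) mu_mx_row.
rewrite size_rcons in szks; rewrite -cats1 walk_cat /=; set t := walk s ks.
have cohO := coherent_opp coh; have cohD := coherent_dual_pattern coh.
have lt_d : (size ks < d)%N by rewrite -szks.
have [] := IH _ lt_d M coh ks s erefl.
rewrite -/t => CV shift.
have [] := IH _ lt_d _ cohD ks s erefl.
rewrite -/t => CVD shiftD.
have [_] := IH _ lt_d _ cohO (rev ks) t (size_rev ks).
rewrite walk_rev => shiftO.
have opp_step : C_mx (opp_pattern M) (nbr l t) s =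
    elem_mx l (csgn (C_mx M s t) l) (M t) *m C_mx (opp_pattern M) t s.
  by rewrite shiftO /shift_sign opp_patternK elem_mxN opprK.
split.
  by rewrite coherent_nbr // opp_step mulmxA -(mulmxA (C_mx M s t)) elem_mxK mulmx1.
move=> k; rewrite !coherent_nbr // [in LHS]shift.
(* Either the sign of column [l] survives the move of [s], and then the shift sign survives the move
   of [t], or both flip. *)
have [eq_l|neq_l] := eqVneq (csgn (C_mx M (nbr k s) t) l) (csgn (C_mx M s t) l).
  rewrite -shift eq_l shift -mulmxA; congr (elem_mx _ (- _) _ *m _).
  (* If the shift sign flipped, column [l] would be a basis vector at [k] up to sign; moving [s]
     would negate it, against [eq_l]. *)
  rewrite /shift_sign; apply/eqP/negPn/negP; rewrite eq_sym => neq_k.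
  have Dk0 : forall i, i != l -> C_mx (opp_pattern M) t s i k = 0.
    apply: (csgn_eq_off (coherent_signs t s cohO) (coherent_signs (nbr l t) s cohO) _ neq_k).
    by move=> i il; rewrite opp_step mul_elem_mxl (negPf il).
  have DC := mulmx1C CV.
  have Dlk := unimodular_col DC (coherent_signs t s cohO) Dk0.
  have Cl i : C_mx M s t i l = csgn (C_mx (opp_pattern M) t s) k * (i == k)%:R.
    apply: unimodular_col_inv CV (csgn_cases _ _) _ => j.
    by case: (eqVneq j l) => [->|jl]; rewrite ?Dlk ?mulr1 // Dk0 ?mulr0.
  have := coherent_signs (nbr k s) t coh l; rewrite eq_l.
  case=> _ /(_ k); rewrite shift mul_elem_mxl eqxx.
  rewrite big1 ?addr0 => [|i ik]; last by rewrite Cl (negPf ik) mulr0 mulr0.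
  have [_ /(_ k)] := coherent_signs s t coh l.
  rewrite Cl eqxx mulr1.
  by case: (csgn_cases (C_mx (opp_pattern M) t s) k) => ->;
     case: (csgn_cases (C_mx M s t) l) => ->; lia.
have Cl0 : forall i, i != k -> C_mx M s t i l = 0.
  apply: (csgn_eq_off (coherent_signs s t coh) (coherent_signs (nbr k s) t coh) _ neq_l).
  by move=> i ik; rewrite shift mul_elem_mxl (negPf ik).
have Dl0 : forall i, i != k -> C_mx (dual_pattern M) s t i l = 0.
  apply: (csgn_eq_off (coherent_signs s t cohD) (coherent_signs (nbr k s) t cohD)).
    by move=> i ik; rewrite shiftD mul_elem_mxl (negPf ik).
  by rewrite !csgn_dual.
have Ckl := unimodular_col CV (coherent_signs s t coh) Cl0.
have Dkl := unimodular_col CVD (coherent_signs s t cohD) Dl0.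
rewrite csgn_dual // in Dkl.
set e := csgn (C_mx M s t) l in neq_l Ckl Dkl opp_step *.
have ee : e = 1 \/ e = -1 by apply: csgn_cases.
clearbody e.
have colC i : C_mx M s t i l = e * (i == k)%:R.
  by case: (eqVneq i k) => [->|ik]; rewrite ?Ckl ?mulr1 // Cl0 ?mulr0.
have colV i : C_mx (opp_pattern M) t s i k = e * (i == l)%:R.
  exact: unimodular_col_inv (mulmx1C CV) ee colC.
have sgnk : shift_sign M s t k = e.
  have [_ /(_ l)] := coherent_signs t s cohO k; rewrite colV eqxx mulr1 /shift_sign.
  exact: sign_eq (csgn_cases _ _) ee.
have sgnk' : shift_sign M s (nbr l t) k = - e.
  have [_ /(_ l)] := coherent_signs (nbr l t) s cohO k.
  rewrite opp_step mul_elem_mxl eqxx big1 ?addr0; last first.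
    by move=> i il; rewrite colV (negPf il) !mulr0.
  rewrite colV eqxx mulr1 /shift_sign opp_step.
  move=> h; apply: sign_eq h; first exact: csgn_cases.
  by case: ee => ->; [right|left].
rewrite -shift; have -> : csgn (C_mx M (nbr k s) t) l = - e.
  by move: neq_l; case: (csgn_cases (C_mx M (nbr k s) t) l) => ->; case: ee => ->.
rewrite shift sgnk sgnk' opprK.
(* By [elem_mx_sq] this compares [E_kk M_s C] with [C E_ll M_t]. Substitute [M_t = D^T M_s C], with
   [D] the dual C-matrix: column [l] of both [C] and [D] is [e] times the basis vector at [k], so
   [C E_ll D^T = E_kk]. *)
have key : elem_mx k e (M s) *m elem_mx k (- e) (M s) *m C_mx M s t =
    C_mx M s t *m (elem_mx l e (M t) *m elem_mx l (- e) (M t)).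
  rewrite !elem_mx_sq ?(coherent_diag coh) // mulmxDl mulmxDr mul1mx mulmx1.
  congr (_ + _); rewrite -scalemxAl -scalemxAr; congr (_ *: _).
  rewrite (exchange_C_mx s t coh) !mulmxA; congr (_ *m _ *m _).
  have colE' (C : 'M[int]_n) : (forall i, C i l = e * (i == k)%:R) ->
      C *m delta_mx l 0 = e *: delta_mx k (0 : 'I_1).
    by move=> Cl; rewrite -colE; apply/matrixP => i j; rewrite !mxE Cl ord1 eqxx andbT.
  rewrite -[in RHS](mul_delta_mx (0 : 'I_1)) mulmxA colE' // -mulmxA.
  rewrite -[delta_mx 0 l]trmxK -trmx_mul trmx_delta colE'.
    rewrite linearZ /= -scalemxAl -scalemxAr scalerA trmx_delta mul_delta_mx.
    by case: ee => ->; rewrite ?mulrNN mulr1 scale1r.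
  by move=> i; case: (eqVneq i k) => [->|ik]; rewrite ?Dkl ?mulr1 // Dl0 ?mulr0.
have := congr1 (mulmx (elem_mx k e (M s))) key.
by rewrite !mulmxA elem_mxK mul1mx => ->; rewrite -!mulmxA elem_mxK mulmx1.
Qed.

Lemma C_mxV M s t : coherent_pattern M ->
  C_mx M s t *m C_mx (opp_pattern M) t s = 1%:M.
Proof.
by move=> coh; have [] := C_mx_shift coh s (erefl (size (geodesic s t)));
  rewrite walk_geodesic.
Qed.

Lemma C_mx_initial M s t k : coherent_pattern M ->
  C_mx M (nbr k s) t = elem_mx k (- shift_sign M s t k) (M s) *m C_mx M s t.
Proof.
by move=> coh; have [] := C_mx_shift coh s (erefl (size (geodesic s t)));
  rewrite walk_geodesic.
Qed.

(* A C-matrix and its inverse determine the same shift signs, so equality of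
   C-matrices propagates to every initial vertex, in particular to t itself. *)
Lemma C_mx_eq_initial M s t t' : coherent_pattern M ->
  C_mx M s t = C_mx M s t' -> forall u,
  C_mx M u t = C_mx M u t' /\ forall k, shift_sign M u t k = shift_sign M u t' k.
Proof.
move=> coh eq_s.
have sign_eq_at u : C_mx M u t = C_mx M u t' ->
    forall k, shift_sign M u t k = shift_sign M u t' k.
  move=> eq_u k; rewrite /shift_sign; congr (csgn _ k).
  rewrite -[LHS]mul1mx -(mulmx1C (C_mxV u t' coh)) -mulmxA -eq_u.
  by rewrite C_mxV // mulmx1.
move=> u; suff eq_u : C_mx M u t = C_mx M u t' by split=> //; apply: sign_eq_at.
move: u; apply: (tree_walk_ind (s := s)) => // u k eq_u.
by rewrite !C_mx_initial // eq_u sign_eq_at.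
Qed.

(** Equal shift signs give [R] independently of the initial vertex. Its column signs are those of
    [C_mx M t t' = 1], so [R >= 0]. Seen from [nbr k t], column [k] has sign -1 while only row [k]
    has changed, so the off-diagonal entries of column [k] are also nonpositive. Thus [R] is
    diagonal, nonnegative and unimodular. *)
Lemma dual_C_mx_eq M s t t' : coherent_pattern M -> C_mx M s t = C_mx M s t' ->
  C_mx (dual_pattern M) s t = C_mx (dual_pattern M) s t'.
Proof.
move=> coh /(C_mx_eq_initial coh) eq_C; have cohD := coherent_dual_pattern coh.
set R := C_mx (dual_pattern M) t t'.
have RE : forall u, C_mx (dual_pattern M) u t' = C_mx (dual_pattern M) u t *m R.
  apply: (tree_walk_ind (s := t)) => [|u k IH]; first by rewrite C_mx_id mul1mx.
  rewrite !C_mx_initial // IH !shift_sign_dual // mulmxA.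
  by have [_ ->] := eq_C u.
suff R1 : R = 1%:M by rewrite RE R1 mulmx1.
have R_ge0 i k : 0 <= R i k.
  have [_ /(_ i)] := coherent_signs t t' cohD k.
  by rewrite csgn_dual // -(eq_C t).1 C_mx_id csgn1 mul1r.
have R_off i k : i != k -> R i k = 0.
  move=> ik; apply/eqP; rewrite eq_le R_ge0 andbT.
  have [_ /(_ i)] := coherent_signs (nbr k t) t' cohD k.
  rewrite csgn_dual // -(eq_C _).1 !C_mx_initial // C_mx_id mulmx1.
  have -> : csgn (elem_mx k (- shift_sign M t t k) (M t)) k = -1.
    by rewrite /csgn; case: forallP => // /(_ k); rewrite mxE !eqxx.
  by rewrite mul_elem_mxl (negPf ik) mulN1r oppr_ge0.
apply/matrixP => i j; rewrite [RHS]mxE; case: (eqVneq i j) => [<-|/R_off //].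
rewrite /R (unimodular_col (C_mxV t t' cohD) (coherent_signs _ _ cohD)).
  by rewrite csgn_dual // -(eq_C t).1 C_mx_id csgn1.
by move=> l; apply: R_off.
Qed.

End Duality.

(** * Laurent polynomials in a field

   A Laurent polynomial is a list of pairs (coefficient, exponent), evaluated
   through a character chi of the exponent group. *)

Section Terms.
Variables (F : fieldType) (G : zmodType).
Implicit Types (l p q : seq (int * G)) (a b : G) (chi : G -> F) (lam : G -> int).

Definition character chi := chi 0 = 1 /\ forall a b, chi (a + b) = chi a * chi b.
Definition weight lam := forall a b, lam (a + b) = lam a + lam b.

Definition ev chi l : F := \sum_(x <- l) x.1%:~R * chi x.2.
Definition coef l a : int := \sum_(x <- l | x.2 == a) x.1.
Definition independent chi := forall l, ev chi l = 0 -> forall a, coef l a = 0.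
Definition term_mul l l' : seq (int * G) :=
  [seq (x.1 * x'.1, x.2 + x'.2) | x <- l, x' <- l'].
Definition term_opp l : seq (int * G) := [seq (- x.1, x.2) | x <- l].
Definition component lam d l := [seq x <- l | lam x.2 == d].
Definition laurent chi f := exists l, f = ev chi l.

Lemma weight0 lam : weight lam -> lam 0 = 0.
Proof. by move=> w; have := w 0 0; rewrite addr0; lia. Qed.

Lemma weightN lam a : weight lam -> lam (- a) = - lam a.
Proof. by move=> w; have := w a (- a); rewrite subrr weight0 //; lia. Qed.

Section Character.
Variable chi : G -> F.
Hypothesis chiP : character chi.

Lemma chi_neq0 a : chi a != 0.
Proof.
apply/eqP => a0; have [c0 cD] := chiP; have := cD a (- a).
by rewrite subrr c0 a0 mul0r => /eqP; rewrite oner_eq0.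
Qed.

Lemma chiN a : chi (- a) = (chi a)^-1.
Proof.
have [c0 cD] := chiP; apply: (mulfI (chi_neq0 a)).
by rewrite -cD subrr c0 divff ?chi_neq0.
Qed.

Lemma chiMz a (z : int) : chi (a *~ z) = chi a ^ z.
Proof.
have [c0 cD] := chiP; have chiMn m : chi (a *+ m) = chi a ^+ m.
  by elim: m => [|m IH]; rewrite ?mulr0n // mulrS cD IH exprS.
by case: z => m; rewrite ?NegzE -?pmulrn ?mulrNz -?pmulrn ?chiN ?chiMn.
Qed.

Lemma ev_nil : ev chi [::] = 0.
Proof. by rewrite /ev big_nil. Qed.

Lemma ev_cons x l : ev chi (x :: l) = x.1%:~R * chi x.2 + ev chi l.
Proof. by rewrite /ev big_cons. Qed.

Lemma ev_cat l l' : ev chi (l ++ l') = ev chi l + ev chi l'.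
Proof. by rewrite /ev big_cat. Qed.

Lemma ev_opp l : ev chi (term_opp l) = - ev chi l.
Proof.
rewrite /ev big_map -sumrN; apply: eq_bigr => x _ /=.
by rewrite mulrNz mulNr.
Qed.

Lemma ev_mul l l' : ev chi (term_mul l l') = ev chi l * ev chi l'.
Proof.
have [_ cD] := chiP.
rewrite /ev big_allpairs_dep /= mulr_suml; apply: eq_bigr => x _.
rewrite mulr_sumr; apply: eq_bigr => x' _ /=.
by rewrite cD intrM; ring.
Qed.

Lemma coef_cat l l' a : coef (l ++ l') a = coef l a + coef l' a.
Proof. by rewrite /coef big_cat. Qed.

Lemma coef_opp l a : coef (term_opp l) a = - coef l a.
Proof. by rewrite /coef big_map sumrN. Qed.

Lemma coef_notin l a : a \notin unzip2 l -> coef l a = 0.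
Proof.
move=> al; rewrite /coef big_seq_cond big1 // => x /andP[xl /eqP xa].
by case/negP: al; rewrite -xa; apply: map_f.
Qed.

Lemma ev_coef l (r : seq G) : uniq r -> {subset unzip2 l <= r} ->
  ev chi l = \sum_(a <- r) (coef l a)%:~R * chi a.
Proof.
move=> ur; elim: l => [|x l IH] sub.
  by rewrite ev_nil big1 // => a _; rewrite /coef big_nil mul0r.
rewrite ev_cons IH => [|a al]; last by apply: sub; rewrite in_cons al orbT.
have xr : x.2 \in r by apply: sub; rewrite mem_head.
rewrite !(bigD1_seq x.2) //= addrA; congr (_ + _).
  by rewrite /coef big_cons eqxx intrD mulrDl.
by apply: eq_bigr => a ax; rewrite /coef big_cons eq_sym (negPf ax).
Qed.

Lemma ev_eq0 l : (forall a, coef l a = 0) -> ev chi l = 0.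
Proof.
move=> l0; rewrite (@ev_coef l (undup (unzip2 l))) ?undup_uniq //.
  by rewrite big1 // => a _; rewrite l0 mul0r.
by move=> a; rewrite mem_undup.
Qed.

Definition normal_form l := [seq (coef l a, a) | a <- undup (unzip2 l) & coef l a != 0].

Lemma ev_normal_form l : ev chi (normal_form l) = ev chi l.
Proof.
rewrite (@ev_coef l (undup (unzip2 l))) ?undup_uniq //; last first.
  by move=> a; rewrite mem_undup.
rewrite /ev big_map big_filter big_mkcond /=; apply: eq_bigr => a _.
by case: eqP => [->|]; rewrite ?mul0r.
Qed.

Lemma normal_form_mem l x : (x \in normal_form l) = (x.1 == coef l x.2) && (coef l x.2 != 0).
Proof.
apply/mapP/andP => [[a]|[/eqP x1 x2]].
  by rewrite mem_filter => /andP[al _] -> /=; rewrite eqxx al.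
exists x.2; last by rewrite -x1; case: x {x1 x2}.
rewrite mem_filter x2 mem_undup; apply: contraTT x2 => /coef_notin ->.
by rewrite eqxx.
Qed.

Lemma component_ev lam d l : independent chi -> ev chi l = 0 ->
  ev chi (component lam d l) = 0.
Proof.
move=> ind l0; apply: ev_eq0 => a; rewrite /coef big_filter_cond.
case: (eqVneq (lam a) d) => [<-|ad].
  rewrite -[RHS](ind l l0 a); apply: eq_bigl => x.
  by case: (eqVneq x.2 a) => [->|]; rewrite ?eqxx ?andbF.
rewrite big1 // => x /andP[/eqP xd /eqP xa].
by rewrite -xd xa eqxx in ad.
Qed.

Lemma component_ev_eq lam d l l' : independent chi -> ev chi l = ev chi l' ->
  ev chi (component lam d l) = ev chi (component lam d l').
Proof.
move=> ind eq_l; apply/eqP; rewrite -subr_eq0 -ev_opp -ev_cat; apply/eqP.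
have -> : component lam d l ++ term_opp (component lam d l') =
    component lam d (l ++ term_opp l').
  by rewrite /component /term_opp filter_cat filter_map.
by apply: component_ev => //; rewrite ev_cat ev_opp eq_l subrr.
Qed.

Lemma laurent_add f g : laurent chi f -> laurent chi g -> laurent chi (f + g).
Proof. by move=> [l ->] [l' ->]; exists (l ++ l'); rewrite ev_cat. Qed.

Lemma laurent_mul f g : laurent chi f -> laurent chi g -> laurent chi (f * g).
Proof. by move=> [l ->] [l' ->]; exists (term_mul l l'); rewrite ev_mul. Qed.

Lemma laurent_opp f : laurent chi f -> laurent chi (- f).
Proof. by move=> [l ->]; exists (term_opp l); rewrite ev_opp. Qed.

Lemma laurent_chi a : laurent chi (chi a).
Proof. by exists [:: (1, a)]; rewrite ev_cons ev_nil addr0 mul1r. Qed.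

Lemma laurent_int (z : int) : laurent chi z%:~R.
Proof. by exists [:: (z, 0)]; rewrite ev_cons ev_nil addr0 chiP.1 mulr1. Qed.

Lemma laurent1 : laurent chi 1.
Proof. exact: (laurent_int 1). Qed.

Lemma laurent_exp f m : laurent chi f -> laurent chi (f ^+ m).
Proof.
move=> lf; elim: m => [|m IH]; first exact: laurent1.
by rewrite exprS; apply: laurent_mul.
Qed.

(* Divide the homogeneous components of g by 1 + chi a, from the lowest up. *)
Lemma grade_cancel lam a b (c : int) l f : independent chi -> weight lam ->
  lam a = 0 -> lam b = 1 -> laurent chi f ->
  (1 + c%:~R * chi b) * ev chi l = (1 + chi a) * f ->
  exists2 g, laurent chi g & ev chi l = (1 + chi a) * g.
Proof.
move=> ind wlam la lb; have [sz] := ubnP (size l); elim: sz l f => // sz IH l f szl [lf ->].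
case: (eqVneq l [::]) => [-> _|l0].
  by exists 0; [exact: (laurent_int 0)|rewrite ev_nil mulr0].
have [d dmin [x0 x0l x0d]] : exists2 d : int, forall x, x \in l -> d <= lam x.2 &
    exists2 x, x \in l & lam x.2 = d.
  elim: l l0 {szl} => // x [|x' l] IHl _.
    by exists (lam x.2) => [y|]; [rewrite inE => /eqP ->|exists x; rewrite ?mem_head].
  have [//|d dmin [y yl yd]] := IHl; case: (leP d (lam x.2)) => [le_d|lt_d].
    exists d => [z|]; first by rewrite inE => /orP[/eqP -> //|/dmin].
    by exists y; rewrite // inE yl orbT.
  exists (lam x.2) => [z|]; last by exists x; rewrite ?mem_head.
  rewrite inE => /orP[/eqP -> //|/dmin]; lia.
move=> eq_l.
(* The factor [chi b] raises degrees by 1 and [chi a] preserves them, so in the lowest degree [d]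
   only [l] itself contributes on the left. *)
have low : ev chi (component lam d l) = (1 + chi a) * ev chi (component lam d lf).
  have e1 : ev chi (l ++ term_mul [:: (c, b)] l) = ev chi (lf ++ term_mul [:: (1, a)] lf).
    rewrite (ev_cat l) (ev_cat lf) !ev_mul !ev_cons !ev_nil !addr0 /= mul1r.
    by move: eq_l; rewrite !mulrDl !mul1r.
  have := component_ev_eq lam d ind e1.
  rewrite /component (filter_cat _ l) (filter_cat _ lf) (ev_cat (filter _ l)) (ev_cat (filter _ lf)).
  have -> : [seq x <- term_mul [:: (c, b)] l | lam x.2 == d] = [::].
    apply/eqP; rewrite -[_ == _]negbK -has_filter; apply/negP => /hasP[x].
    case/allpairsP => -[u v] [/= /[!inE] /eqP -> vl ->] /=.
    by rewrite wlam lb => /eqP e; have := dmin _ vl; rewrite -e gerDr.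
  rewrite ev_nil addr0 => ->.
  have -> : [seq x <- term_mul [:: (1, a)] lf | lam x.2 == d] =
     term_mul [:: (1, a)] [seq x <- lf | lam x.2 == d].
    rewrite /term_mul /= !cats0 filter_map; congr map.
    by apply: eq_filter => x /=; rewrite wlam la add0r.
  by rewrite ev_mul ev_cons ev_nil addr0 mul1r mulrDl mul1r.
pose l' := [seq x <- l | lam x.2 != d].
have split_l : ev chi l = ev chi (component lam d l) + ev chi l'.
  by rewrite /ev /component /l' !big_filter (bigID (fun x => lam x.2 == d)).
have sz' : (size l' < sz)%N.
  rewrite (leq_trans _ (ltnSE szl)) // size_filter -(count_predC (fun x => lam x.2 == d) l).
  rewrite -[X in (X < _)%N]add0n ltn_add2r -has_count; apply/hasP; exists x0 => //.
  by rewrite x0d.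
have [] := IH l' (ev chi lf - (1 + c%:~R * chi b) * ev chi (component lam d lf)) sz'.
- apply: laurent_add; first by exists lf.
  apply/laurent_opp/laurent_mul; last by eexists.
  by apply: laurent_add; [exact: laurent1|apply: laurent_mul; [exact: laurent_int|exact: laurent_chi]].
- by rewrite mulrBr -eq_l split_l low; ring.
move=> g lg eq_l'; exists (ev chi (component lam d lf) + g).
  by apply: laurent_add => //; eexists.
by rewrite split_l low eq_l' mulrDr.
Qed.

(* Y is a non-zero-divisor modulo X in the ring of Laurent polynomials. *)
Definition regular_mod (X Y : F) := forall f g, laurent chi f -> laurent chi g ->
  Y * f = X * g -> exists2 h, laurent chi h & f = X * h.

Lemma regular_mod_mul X Y Z : laurent chi Z ->
  regular_mod X Y -> regular_mod X Z -> regular_mod X (Y * Z).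
Proof.
move=> lZ rY rZ f g lf lg; rewrite -mulrA => /rY[|//|h lh eq_h].
  exact: laurent_mul.
exact: rZ eq_h.
Qed.

Lemma regular_mod_exp X Y m : laurent chi Y -> regular_mod X Y -> regular_mod X (Y ^+ m).
Proof.
move=> lY rY; elim: m => [|m IH] ; last by rewrite exprSr; apply: regular_mod_mul.
by move=> f g _ lg; rewrite mul1r => ->; exists g.
Qed.

Lemma regular_mod_shift X Y Z : laurent chi Z ->
  regular_mod X Y -> regular_mod X (Y + X * Z).
Proof.
move=> lZ rY f g lf lg eq_fg; apply: (rY f (g - Z * f)) => //.
  by apply/laurent_add/laurent_opp/laurent_mul.
by rewrite mulrBr -eq_fg; ring.
Qed.

Lemma regular_mod_chi X a : regular_mod X (chi a).
Proof.
move=> f g _ lg eq_fg; exists (chi (- a) * g).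
  by apply: laurent_mul => //; apply: laurent_chi.
by rewrite mulrCA -eq_fg mulrA chiN mulVf ?mul1r ?chi_neq0.
Qed.

(** The denominator [X ^+ m] is stripped one factor at a time: [Y] times the numerator is divisible
    by [X], hence so is the numerator. *)
Lemma regular_mod_cancel X Y f m : X != 0 -> laurent chi X -> laurent chi Y ->
  regular_mod X Y -> laurent chi (f * X ^+ m) -> laurent chi (f * Y) -> laurent chi f.
Proof.
move=> X0 lX lY rY; elim: m => [|m IH]; first by rewrite mulr1.
move=> lf lfY; apply: IH => //.
have [||h lh] := rY _ (f * Y * X ^+ m) lf.
- by apply: laurent_mul => //; apply: laurent_exp.
- by rewrite exprS; ring.
by rewrite exprS mulrCA => /(mulfI X0) ->.
Qed.

Definition laurent_away (Y f : F) := exists m, laurent chi (f * Y ^+ m).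

Section Away.
Variable Y : F.
Hypothesis lY : laurent chi Y.

Lemma away_laurent f : laurent chi f -> laurent_away Y f.
Proof. by exists 0; rewrite mulr1. Qed.

Lemma away_add f g : laurent_away Y f -> laurent_away Y g -> laurent_away Y (f + g).
Proof.
move=> [m lf] [m' lg]; exists (m + m')%N; rewrite mulrDl.
apply: laurent_add; last rewrite addnC; rewrite exprD mulrA; apply: laurent_mul => //;
  exact: laurent_exp.
Qed.

Lemma away_mul f g : laurent_away Y f -> laurent_away Y g -> laurent_away Y (f * g).
Proof.
move=> [m lf] [m' lg]; exists (m + m')%N.
by rewrite exprD mulrACA; apply: laurent_mul.
Qed.

Lemma away_exp f (z : int) : laurent_away Y f -> laurent_away Y f^-1 ->
  laurent_away Y (f ^ z).
Proof.
have awayX g m : laurent_away Y g -> laurent_away Y (g ^+ m).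
  move=> ag; elim: m => [|m IH]; first exact/away_laurent/laurent1.
  by rewrite exprS; apply: away_mul.
by move=> af afV; case: z => m; rewrite ?NegzE -?exprnN -?exprVn; apply: awayX.
Qed.

Lemma away_prod (I : finType) (f : I -> F) :
  (forall i, laurent_away Y (f i)) -> laurent_away Y (\prod_i f i).
Proof.
by move=> af; elim/big_ind: _ => //; [exact/away_laurent/laurent1|exact: away_mul].
Qed.

Lemma away_ev (chi' : G -> F) f : (forall a, laurent_away Y (chi' a)) ->
  laurent chi' f -> laurent_away Y f.
Proof.
move=> ac [l ->]; elim: l => [|t l IH].
  by rewrite /ev big_nil; apply/away_laurent/(laurent_int 0).
rewrite /ev big_cons; apply: away_add => //; apply: away_mul => //.
exact/away_laurent/laurent_int.
Qed.

End Away.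

End Character.
End Terms.

(** * Max-plus valuations of subtraction-free elements *)

Section Valuation.
Variables (F : fieldType) (G : zmodType).
Implicit Types (l p q : seq (int * G)) (a b : G) (chi : G -> F) (lam : G -> int).

Definition positive l : bool := (l != [::]) && all (fun x => 0 < x.1) l.

Definition topdeg lam l (d : int) :=
  (exists2 x, x \in l & lam x.2 = d) /\ forall x, x \in l -> lam x.2 <= d.

(* The max-plus valuation with weight lam, on quotients of Laurent polynomials
   with positive coefficients: nothing cancels there. *)
Definition tropval chi lam (f : F) (d : int) := exists p q dp dq,
  [/\ positive p, positive q, topdeg lam p dp & topdeg lam q dq] /\
  f = ev chi p / ev chi q /\ d = dp - dq.

Lemma add_eq_bound (a b c d : int) : a <= c -> b <= d -> a + b = c + d -> a = c.
Proof. lia. Qed.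

Lemma topdeg_exists lam l : l != [::] -> exists d, topdeg lam l d.
Proof.
elim: l => // x [|x' l] IH _.
  by exists (lam x.2); split=> [|y]; [exists x; rewrite ?mem_head|rewrite inE => /eqP ->].
have [//|d [[y yl yd] dmax]] := IH; case: (leP d (lam x.2)) => [le_d|/ltW lt_d].
  exists (lam x.2); split=> [|z]; first by exists x; rewrite ?mem_head.
  rewrite inE => /orP[/eqP -> //|/dmax]; move/le_trans; exact.
exists d; split=> [|z]; first by exists y; rewrite // inE yl orbT.
by rewrite inE => /orP[/eqP -> //|/dmax].
Qed.

Lemma topdeg_uniq lam l l' d d' : {subset unzip2 l <= unzip2 l'} ->
  {subset unzip2 l' <= unzip2 l} -> topdeg lam l d -> topdeg lam l' d' -> d = d'.
Proof.
move=> sub sub' [[x xl <-] xmax] [[y yl <-] ymax]; apply: le_anti; apply/andP; split.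
  by have /mapP[z zl ->] := sub _ (map_f snd xl); apply: ymax.
by have /mapP[z zl ->] := sub' _ (map_f snd yl); apply: xmax.
Qed.

Lemma topdeg_cat lam l l' d d' : topdeg lam l d -> topdeg lam l' d' ->
  topdeg lam (l ++ l') (Num.max d d').
Proof.
move=> [[x xl xd] xmax] [[y yl yd] ymax]; split=> [|z].
  case: (leP d d') => _; [exists y|exists x]; rewrite ?mem_cat ?yl ?xl ?orbT //.
by rewrite mem_cat le_max => /orP[/xmax -> //|/ymax ->]; rewrite orbT.
Qed.

Lemma topdeg_mul lam l l' d d' : weight lam -> topdeg lam l d -> topdeg lam l' d' ->
  topdeg lam (term_mul l l') (d + d').
Proof.
move=> w [[x xl <-] xmax] [[y yl <-] ymax]; split=> [|z].
  by exists (x.1 * y.1, x.2 + y.2); rewrite ?w //; apply/allpairsP; exists (x, y).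
by case/allpairsP=> -[u v] /= [/xmax ul /ymax vl ->]; rewrite /= w lerD.
Qed.

Lemma positive_cat l l' : positive l -> positive l' -> positive (l ++ l').
Proof.
move=> /andP[l0 lp] /andP[_ lp']; rewrite /positive all_cat lp lp' !andbT.
by case: l l0 {lp}.
Qed.

Lemma positive_mul l l' : positive l -> positive l' -> positive (term_mul l l').
Proof.
move=> /andP[l0 lp] /andP[l0' lp']; apply/andP; split.
  by case: l l0 {lp} => // x l _; case: l' l0' {lp'}.
apply/allP => _ /allpairsP[[x y] /= [xl yl ->]] /=.
by rewrite mulr_gt0 //; [move/allP: lp; apply|move/allP: lp'; apply].
Qed.

Lemma positive_coef l a : positive l -> (0 < coef l a) = (a \in unzip2 l).
Proof.
move=> /andP[_ lp]; apply/idP/idP => [|/mapP[x xl ->]].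
  by apply: contraTT => /coef_notin ->.
have sum_ge0 : 0 <= \sum_(y <- rem x l | y.2 == x.2) y.1.
  rewrite big_seq_cond sumr_ge0 // => y /andP[/mem_rem yl _].
  by apply/ltW; move/allP: lp => /(_ _ yl).
rewrite /coef (perm_big _ (perm_to_rem xl)) big_cons eqxx /=.
by apply: ltr_wpDr => //; move/allP: lp => /(_ _ xl).
Qed.

Section Chi.
Variables (chi : G -> F) (lam : G -> int).
Hypotheses (chiP : character chi) (ind : independent chi) (wlam : weight lam).

Lemma ev_positive_neq0 l : positive l -> ev chi l != 0.
Proof.
move=> lp; apply/eqP => /ind l0; case/andP: (lp); case: l lp l0 => // x l lp l0 _ _.
by have := positive_coef x.2 lp; rewrite l0 ltxx mem_head.
Qed.

Lemma positive_ev_eq l l' : positive l -> positive l' -> ev chi l = ev chi l' ->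
  {subset unzip2 l <= unzip2 l'}.
Proof.
move=> lp lp' eq_l a; rewrite -!positive_coef //.
have /ind/(_ a) : ev chi (l ++ term_opp l') = 0 by rewrite ev_cat ev_opp eq_l subrr.
by rewrite coef_cat coef_opp => /eqP; rewrite subr_eq0 => /eqP ->.
Qed.

Lemma tropval_neq0 f d : tropval chi lam f d -> f != 0.
Proof.
by move=> [p [q [dp [dq [[pp qp _ _] [-> _]]]]]]; rewrite mulf_neq0 ?invr_neq0 ?ev_positive_neq0.
Qed.

(** Cross-multiplying gives two equal sums with positive coefficients; by independence they have the
    same exponents, hence the same top degree. *)
Lemma tropval_uniq f d d' : tropval chi lam f d -> tropval chi lam f d' -> d = d'.
Proof.
move=> [p [q [dp [dq [[pp qp tp tq] [-> ->]]]]]].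
move=> [p' [q' [dp' [dq' [[pp' qp' tp' tq'] [eq_f ->]]]]]].
have eq_ev : ev chi (term_mul p q') = ev chi (term_mul p' q).
  move/eqP: eq_f; rewrite !ev_mul // eqr_div ?ev_positive_neq0 // => /eqP ->.
  by [].
have pos1 := positive_mul pp qp'; have pos2 := positive_mul pp' qp.
have := topdeg_uniq (positive_ev_eq pos1 pos2 eq_ev) (positive_ev_eq pos2 pos1 (esym eq_ev))
  (topdeg_mul wlam tp tq') (topdeg_mul wlam tp' tq).
lia.
Qed.

Lemma tropval_mul f g d e : tropval chi lam f d -> tropval chi lam g e -> tropval chi lam (f * g) (d + e).
Proof.
move=> [p [q [dp [dq [[pp qp tp tq] [-> ->]]]]]].
move=> [p' [q' [dp' [dq' [[pp' qp' tp' tq'] [-> ->]]]]]].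
exists (term_mul p p'), (term_mul q q'), (dp + dp'), (dq + dq'); split.
  by split; [exact: positive_mul|exact: positive_mul|exact: topdeg_mul|exact: topdeg_mul].
by rewrite !ev_mul // mulf_div; split=> //; ring.
Qed.

Lemma tropval_inv f d : tropval chi lam f d -> tropval chi lam f^-1 (- d).
Proof.
move=> [p [q [dp [dq [[pp qp tp tq] [-> ->]]]]]].
by exists q, p, dq, dp; rewrite invf_div opprB.
Qed.

Lemma tropval_add f g d e : tropval chi lam f d -> tropval chi lam g e ->
  tropval chi lam (f + g) (Num.max d e).
Proof.
move=> [p [q [dp [dq [[pp qp tp tq] [-> ->]]]]]].
move=> [p' [q' [dp' [dq' [[pp' qp' tp' tq'] [-> ->]]]]]].
exists (term_mul p q' ++ term_mul p' q), (term_mul q q'),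
  (Num.max (dp + dq') (dp' + dq)), (dq + dq'); split.
  split; [by apply: positive_cat; apply: positive_mul | exact: positive_mul | | exact: topdeg_mul].
  by apply: topdeg_cat; apply: topdeg_mul.
split; last by lia.
by rewrite (ev_cat chi (term_mul p q')) !ev_mul // addf_div ?ev_positive_neq0.
Qed.

Lemma tropval_positive p d : positive p -> topdeg lam p d -> tropval chi lam (ev chi p) d.
Proof.
move=> pp tp; exists p, [:: (1, 0)], d, 0; split.
  split=> //; split=> [|x]; first by exists (1, 0); rewrite ?mem_head ?weight0.
  by rewrite inE => /eqP -> /=; rewrite weight0.
by rewrite ev_cons ev_nil chiP.1 !mulr1 addr0 invr1 mulr1 subr0.
Qed.

Lemma tropval_term (c : int) a : 0 < c -> tropval chi lam (c%:~R * chi a) (lam a).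
Proof.
move=> c0; have := @tropval_positive [:: (c, a)] (lam a).
rewrite ev_cons ev_nil addr0; apply; first by rewrite /positive /= c0.
by split=> [|x]; [exists (c, a); rewrite ?mem_head|rewrite inE => /eqP ->].
Qed.

Lemma tropval_chi a : tropval chi lam (chi a) (lam a).
Proof. by have := @tropval_term 1 a isT; rewrite mul1r. Qed.

Lemma tropval1 : tropval chi lam 1 0.
Proof. by have := tropval_chi 0; rewrite chiP.1 weight0. Qed.

Lemma tropval_int (c : int) : 0 < c -> tropval chi lam c%:~R 0.
Proof. by move=> c0; have := tropval_term 0 c0; rewrite chiP.1 mulr1 weight0. Qed.

Lemma tropval_exp f d (z : int) : tropval chi lam f d -> tropval chi lam (f ^ z) (d * z).
Proof.
move=> vf; have vX m : tropval chi lam (f ^+ m) (d * m%:Z).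
  elim: m => [|m IH]; first by rewrite mulr0; apply: tropval1.
  by rewrite exprS -addn1 PoszD mulrDr mulr1 addrC; apply: tropval_mul.
case: z => m; first exact: vX.
by rewrite NegzE mulrN -invr_expz; apply: tropval_inv; apply: (vX m.+1).
Qed.

(** The coefficients of [l] may have either sign. Write the value as [p / q] with [p], [q] positive:
    the top component of [l * q] is a product of two nonzero top components, so it does not cancel
    and must match that of [p]. *)
Lemma tropval_laurent l d : tropval chi lam (ev chi l) d ->
  (forall a, coef l a != 0 -> lam a <= d) /\ exists2 a, coef l a != 0 & lam a = d.
Proof.
rewrite -ev_normal_form; set l' := normal_form l => vl.
have l0 : l' != [::].
  by apply: contraTneq (tropval_neq0 vl) => ->; rewrite ev_nil eqxx.
have [D tl] := topdeg_exists lam l0.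
move: vl => [p [q [dp [dq [[pp qp tp tq] [eq_l ->]]]]]].
have eq_ev : ev chi (term_mul l' q) = ev chi p.
  by rewrite ev_mul // eq_l divfK ?ev_positive_neq0.
have memE a : coef l a != 0 -> (coef l a, a) \in l'.
  by move=> al; rewrite normal_form_mem eqxx.
have top_neq0 (k : seq (int * G)) e : (exists2 x, x \in k & lam x.2 = e) ->
    (forall x, x \in k -> x.1 = coef k x.2 /\ coef k x.2 != 0) \/ positive k ->
    ev chi (component lam e k) != 0.
  move=> [x xk xe] hk; apply/eqP => /ind/(_ x.2).
  have -> : coef (component lam e k) x.2 = coef k x.2.
    rewrite /coef big_filter_cond; apply: eq_bigl => y.
    by case: (eqVneq y.2 x.2) => [->|]; rewrite ?andbF // xe eqxx.
  case: hk => [/(_ x xk)[_ /eqP]//|kp].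
  by have := positive_coef x.2 kp; rewrite (map_f snd xk) => /lt0r_neq0/eqP.
suff -> : dp - dq = D.
  case: tl => [[x xl xD] lmax]; split=> [a /memE/lmax //|].
  by exists x.2 => //; move: xl; rewrite normal_form_mem => /andP[].
have tlq := topdeg_mul wlam tl tq.
suff /le_anti : D + dq <= dp <= D + dq by lia.
apply/andP; split.
  have : ev chi (component lam (D + dq) (term_mul l' q)) != 0.
    have -> : ev chi (component lam (D + dq) (term_mul l' q)) =
        ev chi (component lam D l') * ev chi (component lam dq q).
      rewrite -ev_mul // /ev /component !big_filter big_mkcond /= !big_allpairs_dep /=.
      rewrite big_filter [RHS]big_mkcond /=.
      rewrite big_seq [RHS]big_seq; apply: eq_bigr => x xl.
      have xD := tl.2 x xl; case: eqP => xD'.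
        rewrite big_filter [RHS]big_mkcond /=; apply: eq_bigr => y _.
        by rewrite wlam xD' (inj_eq (addrI _)).
      rewrite big_seq big1 // => y yq; have := tq.2 y yq.
      by rewrite wlam; case: eqP => // e yD; case: xD'; apply: add_eq_bound xD yD e.
    rewrite mulf_neq0 ?top_neq0 //; [exact: tl.1| |exact: tq.1|by right].
    left=> x xl; have := xl; rewrite normal_form_mem => /andP[/eqP x1 x2].
    suff -> : coef l' x.2 = coef l x.2 by [].
    have /ind/(_ x.2)/eqP : ev chi (l' ++ term_opp l) = 0.
      by rewrite ev_cat ev_opp ev_normal_form subrr.
    by rewrite coef_cat coef_opp subr_eq0 => /eqP.
  rewrite (component_ev_eq _ _ ind eq_ev).
  case E: (component lam (D + dq) p) => [|x k]; first by rewrite ev_nil eqxx.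
  have : x \in component lam (D + dq) p by rewrite E mem_head.
  by rewrite mem_filter => /andP[/eqP <- /tp.2].
have : ev chi (component lam dp p) != 0 by apply: top_neq0 tp.1 _; right.
rewrite -(component_ev_eq _ _ ind eq_ev).
case E: (component lam dp _) => [|x k]; first by rewrite ev_nil eqxx.
have : x \in component lam dp (term_mul l' q) by rewrite E mem_head.
by rewrite mem_filter => /andP[/eqP <- /tlq.2].
Qed.

Lemma tropval_ev (chi' : G -> F) (lam' : G -> int) p d :
  (forall a, tropval chi lam (chi' a) (lam' a)) ->
  positive p -> topdeg lam' p d -> tropval chi lam (ev chi' p) d.
Proof.
move=> vchi; elim: p d => // x p IH d /andP[_ /= /andP[x0 pp]] tp.
have vx : tropval chi lam (x.1%:~R * chi' x.2) (lam' x.2).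
  by rewrite -[lam' _]add0r; apply: tropval_mul (tropval_int x0) _.
case: (eqVneq p [::]) => [p0|pn0].
  move: tp; rewrite p0 ev_cons ev_nil addr0 => -[[y]].
  by rewrite inE => /eqP -> <-.
have [e te] := topdeg_exists lam' pn0.
have tx : topdeg lam' [:: x] (lam' x.2).
  by split=> [|y]; [exists x; rewrite ?mem_head|rewrite inE => /eqP ->].
rewrite (topdeg_uniq (fun _ => id) (fun _ => id) tp (topdeg_cat tx te)) ev_cons.
by apply: tropval_add => //; apply: IH te; rewrite /positive pn0.
Qed.

Lemma tropval_transfer (chi' : G -> F) (lam' : G -> int) f d :
  (forall a, tropval chi lam (chi' a) (lam' a)) ->
  tropval chi' lam' f d -> tropval chi lam f d.
Proof.
move=> vchi [p [q [dp [dq [[pp qp tp tq] [-> ->]]]]]].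
apply: tropval_mul; first exact: tropval_ev tp.
by apply: tropval_inv; apply: tropval_ev tq.
Qed.

End Chi.

(** Collect the positive and the negative terms of a relation on opposite sides: their values agree.
    As [lam'] separates the exponents, one exponent is the top of both sides, so its coefficient
    would be both positive and negative. *)
Lemma independent_transfer chi chi' : character chi -> independent chi ->
  (forall r : seq G, exists lam lam', [/\ weight lam,
     forall a, tropval chi lam (chi' a) (lam' a) & {in r &, injective lam'}]) ->
  independent chi'.
Proof.
move=> chiP ind gen l l0 a; have [lam [lam' [wlam vchi inj]]] := gen (unzip2 l).
have memP c : coef l c != 0 -> c \in unzip2 l.
  by apply: contraNT => /coef_notin ->.
pose lp : seq (int * G) := [seq x <- normal_form l | 0 < x.1].
pose lm := term_opp [seq x <- normal_form l | ~~ (0 < x.1)].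
have eq_ev : ev chi' lp = ev chi' lm.
  apply/eqP; rewrite -subr_eq0 ev_opp opprK -[X in _ == X]l0 -[ev chi' l]ev_normal_form.
  by rewrite /ev !big_filter eq_sym (bigID (fun x : int * G => 0 < x.1)).
have lp_mem x : x \in lp -> x.1 = coef l x.2 /\ 0 < x.1.
  by rewrite mem_filter normal_form_mem => /and3P[-> /eqP].
have lm_mem x : x \in lm -> x.1 = - coef l x.2 /\ 0 < x.1.
  move=> /mapP[y]; rewrite mem_filter normal_form_mem => /and3P[y0 /eqP y1 y2] -> /=.
  by rewrite oppr_gt0 lt_neqAle y1 y2 leNgt -y1.
have pos (k : seq (int * G)) : k != [::] -> (forall x, x \in k -> 0 < x.1) -> positive k.
  by move=> k0 kp; rewrite /positive k0; apply/allP.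
have pos_neq0 k : positive k -> ev chi' k != 0.
  move=> kp; have [d td] := topdeg_exists lam' (proj1 (andP kp)).
  have vk := tropval_ev chiP ind wlam vchi kp td.
  exact: (tropval_neq0 ind vk).
case: (eqVneq lp [::]) => [lp0|lpn0].
  case: (eqVneq lm [::]) => [lm0|lmn0].
    apply/eqP; apply: contraT => al.
    have : (coef l a, a) \in normal_form l by rewrite normal_form_mem eqxx.
    move: lm0 => /eqP; rewrite -size_eq0 size_map size_eq0 => /eqP lm0.
    case: (boolP (0 < coef l a)) => al0 am.
      have : (coef l a, a) \in lp by rewrite mem_filter al0.
      by rewrite lp0.
    have : (coef l a, a) \in [seq x <- normal_form l | ~~ (0 < x.1)] by rewrite mem_filter al0.
    by rewrite lm0.
  have := pos_neq0 lm (pos _ lmn0 (fun x xl => (lm_mem x xl).2)).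
  by rewrite -eq_ev lp0 ev_nil eqxx.
have pp := pos _ lpn0 (fun x xl => (lp_mem x xl).2).
have pm : positive lm.
  apply: pos => [|x /lm_mem[]//].
  by apply: contraTneq (pos_neq0 _ pp) => lm0; rewrite eq_ev lm0 ev_nil eqxx.
have [d td] := topdeg_exists lam' lpn0.
have [e te] := topdeg_exists lam' (proj1 (andP pm)).
have vd := tropval_ev chiP ind wlam vchi pp td.
have ve := tropval_ev chiP ind wlam vchi pm te.
rewrite eq_ev in vd; have de := tropval_uniq chiP ind wlam vd ve.
case: td te => [[x /lp_mem[x1 x0] xd] _] [[y /lm_mem[y1 y0] ye] _].
have xy : x.2 = y.2.
  by apply: inj; [apply: memP; rewrite -x1 gt_eqF|apply: memP; rewrite -oppr_eq0 -y1 gt_eqF|rewrite xd ye].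
by move: y0; rewrite y1 -xy -x1 oppr_gt0 ltNge ltW.
Qed.

End Valuation.

(** * Weights *)

Notation expo n := ('cV[int]_n * 'cV[int]_n)%type.

Section Weights.
Variable n : nat.
Implicit Types (v w : 'cV[int]_n) (a b : expo n).

Definition wt v w a : int := \sum_i v i 0 * a.1 i 0 + \sum_i w i 0 * a.2 i 0.

Lemma wt_weight v w : weight (wt v w).
Proof.
move=> a b; rewrite /wt [RHS]addrACA; congr (_ + _); rewrite -big_split;
  by apply: eq_bigr => i _; rewrite mxE mulrDr.
Qed.

Lemma int_nonroot (p : {poly int}) (m : nat) : p != 0 ->
  exists2 N : nat, (m < N)%N & p.[N%:R] != 0.
Proof.
move=> p0; pose rs : seq int := [seq (i%:R : int) | i <- iota m.+1 (size p)].
have urs : uniq rs.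
  rewrite map_inj_uniq ?iota_uniq // => i j /eqP.
  by rewrite eqr_nat => /eqP.
case: (boolP (all (root p) rs)) => [/(max_poly_roots p0)/(_ urs)|].
  by rewrite size_map size_iota ltnn.
move/allPn => [x /mapP[N]]; rewrite mem_iota => /andP[mN _] -> pN.
by exists N.
Qed.

(* Take powers of a large integer N that is a root of none of the finitely many
   polynomials attached to the given exponents. *)
Lemma generic_weight (B : 'M[int]_n) (r : seq (expo n)) : exists v w,
  (forall j, (B^T *m v + w) j 0 < 0) /\ forall a, a \in r -> a != 0 -> wt v w a != 0.
Proof.
(* Its value at [N] is the weight of [a] for [v_i = N^i] and [w_j = -N^(n+j)]. *)
pose P a : {poly int} := rVpoly (row_mx a.1^T (- a.2^T)).
have P0 a : a != 0 -> P a != 0.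
  apply: contraNneq => Pa0; have : row_mx a.1^T (- a.2^T) = 0.
    by rewrite -[LHS]rVpolyK -/(P a) Pa0 linear0.
  rewrite -row_mx0 => /eq_row_mx[/eqP]; rewrite trmx_eq0 => /eqP a1 /eqP.
  rewrite oppr_eq0 trmx_eq0 => /eqP a2.
  by case: a a1 a2 {Pa0} => a1 a2 /= -> ->.
have PE a (x : int) : (P a).[x] = \sum_(i < n) a.1 i 0 * x ^+ i
    - \sum_(j < n) a.2 j 0 * x ^+ (n + j).
  rewrite horner_poly big_split_ord -sumrN /=; congr (_ + _).
    apply: eq_bigr => i _; rewrite (_ : insub _ = Some (lshift n i)) ?row_mxEl ?mxE //.
    exact: (valK (lshift n i)).
  apply: eq_bigr => j _; rewrite (_ : insub _ = Some (rshift n j)) ?row_mxEr ?mxE ?mulNr //.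
  exact: (valK (rshift n j)).
pose Q := \prod_(a <- r | a != 0) P a.
have Q0 : Q != 0 by rewrite prodf_seq_neq0; apply/allP => a _; apply/implyP/P0.
(* For [N > m] the entries of [B^T v] stay below [N^n], so every [w_j] outweighs them. *)
pose m := absz (\sum_j \sum_i `|B i j|)%R.
have [N mN QN] := int_nonroot m Q0.
exists (\col_i N%:R ^+ i), (\col_j - (N%:R ^+ (n + j))); split=> [j|a ar a0].
  rewrite !mxE subr_lt0; case: n B j @m mN {P P0 PE Q Q0 QN r} => [|n'] B j m mN; first by case: j.
  have N1 : (1 <= N%:R :> int) by rewrite ler1n; apply: leq_trans mN.
  apply: (@le_lt_trans _ _ (\sum_i `|B i j| * N%:R ^+ n')).
    apply: ler_sum => i _; rewrite !mxE.
    apply: le_trans (ler_norm _) _; rewrite normrM ler_wpM2l //.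
    rewrite ger0_norm ?exprn_ge0 ?ler0n // ler_weXn2l // -ltnS; exact: ltn_ord.
  rewrite -mulr_suml; apply: (@lt_le_trans _ _ (N%:R ^+ n'.+1)); last first.
    by rewrite ler_weXn2l // leq_addr.
  have N0 : (0 < N%:R :> int) by apply: lt_le_trans N1.
  rewrite exprS ltr_pM2r ?exprn_gt0 //.
  have mN' : (m%:R < N%:R :> int) by rewrite ltr_nat.
  apply: (le_lt_trans _ mN'); rewrite natz /m abszE [leRHS]ger0_norm; last first.
    by apply: sumr_ge0 => i _; apply: sumr_ge0.
  by rewrite [leRHS](bigD1 j) //= lerDl; apply: sumr_ge0 => i _; apply: sumr_ge0.
move: QN; rewrite horner_prod prodf_seq_neq0 => /allP/(_ a ar)/implyP/(_ a0).
suff -> : (P a).[N%:R] = wt (\col_i N%:R ^+ i) (\col_j - (N%:R ^+ (n + j))) a by [].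
rewrite PE /wt -sumrN; congr (_ + _); apply: eq_bigr => i _; rewrite !mxE ?mulNr;
  by rewrite mulrC.
Qed.

End Weights.

(** * Charts of a cluster pattern *)

Section Chart.
Variables (F : fieldType) (n : nat) (y : 'I_n -> F).
Implicit Types (x : 'I_n -> F) (a b : expo n).

Definition chart x a : F := (\prod_i x i ^ a.1 i 0) * trop_eval y a.2.

Lemma chart_character x : (forall i, x i != 0) -> (forall i, y i != 0) ->
  character (chart x).
Proof.
move=> x0 y0; split.
  by rewrite /chart /trop_eval !big1 ?mulr1 // => i _; rewrite mxE expr0z.
move=> a b; rewrite /chart /trop_eval [RHS]mulrACA.
by congr (_ * _); rewrite -big_split; apply: eq_bigr => i _; rewrite mxE expfzDr.
Qed.

Lemma free_generators_neq0 m (z : 'I_m -> F) i : free_generators z -> z i != 0.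
Proof.
move=> [free _]; apply/eqP => zi0; have := free 'X_i.
rewrite mmapX mmap1U zi0 => /(_ erefl)/(congr1 (fun p => p@_(U_(i)))).
by rewrite mcoeffX eqxx mcoeff0.
Qed.

Lemma chart_independent x : free_generators (join_vars x y) -> independent (chart x).
Proof.
move=> free; set z := join_vars x y.
have x0 i : x i != 0.
  have := free_generators_neq0 (lshift n i) free.
  by rewrite /join_vars (unsplitK (inl i : 'I_n + 'I_n)).
have y0 i : y i != 0.
  have := free_generators_neq0 (rshift n i) free.
  by rewrite /join_vars (unsplitK (inr i : 'I_n + 'I_n)).
have chiP := chart_character x0 y0.
move=> l l0 a; have [al|/coef_notin //] := boolP (a \in unzip2 l).
(* [N] bounds all exponents present, so multiplying by the monomial [u] below clears all
   denominators and yields a polynomial relation. *)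
pose N : int := \sum_(b <- unzip2 l) \sum_i (`|b.1 i 0| + `|b.2 i 0|).
have bound b i : b \in unzip2 l -> `|b.1 i 0| <= N /\ `|b.2 i 0| <= N.
  move=> bl; suff : `|b.1 i 0| + `|b.2 i 0| <= N.
    have := normr_ge0 (b.1 i 0); have := normr_ge0 (b.2 i 0); lia.
  rewrite /N (perm_big _ (perm_to_rem bl)) big_cons (bigD1 i) //= -addrA lerDl.
  by rewrite addr_ge0 ?sumr_ge0 // => c _; rewrite ?sumr_ge0 // => ? _; rewrite addr_ge0.
pose e b (i : 'I_(n + n)) : int := match split i with inl j => b.1 j 0 | inr j => b.2 j 0 end.
pose mn b : 'X_{1..n + n} := [multinom absz (N + e b i)%R | i < n + n].
pose p : {mpoly int[n + n]} := \sum_(t <- l) t.1 *: 'X_[mn t.2].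
pose u : expo n := (const_mx N, const_mx N).
have eb b i : b \in unzip2 l -> 0 <= N + e b i.
  move=> bl; rewrite /e; case: (split i) => j; have [h1 h2] := bound b j bl.
    by move: h1; rewrite ler_norml => /andP[+ _]; lia.
  by move: h2; rewrite ler_norml => /andP[+ _]; lia.
have monE b : b \in unzip2 l -> mmap1 z (mn b) = chart x (u + b).
  move=> bl; rewrite /mmap1 big_split_ord /chart /trop_eval /=; congr (_ * _);
    apply: eq_bigr => i _; rewrite mnmE /z /join_vars exprnP gez0_abs ?eb // !mxE /e.
    by rewrite (unsplitK (inl i : 'I_n + 'I_n)).
  by rewrite (unsplitK (inr i : 'I_n + 'I_n)).
have p0 : p = 0.
  apply: free.1; rewrite raddf_sum /=.
  transitivity (chart x u * ev (chart x) l); last by rewrite l0 mulr0.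
  rewrite /ev mulr_sumr big_seq [RHS]big_seq.
  apply: eq_bigr => t tl; rewrite mmapZ mmapX monE ?map_f // chiP.2; ring.
transitivity (mcoeff (mn a) p); last by rewrite p0 mcoeff0.
rewrite raddf_sum /= /coef big_mkcond /= big_seq [RHS]big_seq.
apply: eq_bigr => t tl; rewrite mcoeffZ mcoeffX.
have -> : (mn t.2 == mn a) = (t.2 == a).
  apply/eqP/eqP => [/mnmP h|-> //]; have tl' := map_f snd tl.
  have h' i : e t.2 i = e a i.
    have := h i; rewrite !mnmE => /(congr1 Posz); rewrite !gez0_abs ?eb //; exact: addrI.
  case: (t.2) (a) h' => [t1 t2] [a1 a2] h'; congr (_, _);
    apply/matrixP => i j; rewrite ord1.
    by have := h' (lshift n i); rewrite /e (unsplitK (inl i : 'I_n + 'I_n)).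
  by have := h' (rshift n i); rewrite /e (unsplitK (inr i : 'I_n + 'I_n)).
by case: eqP => _; rewrite ?mulr1 ?mulr0.
Qed.

End Chart.

Section Pattern.
Variables (F : fieldType) (n : nat) (y : 'I_n -> F) (t0 : tree n) (S : tree n -> seed F n).
Hypothesis hS : principal_coefficients y t0 S.
Hypothesis hB : forall t : tree n, totally_sign_skew_symmetric (exch (S t)).
Hypothesis hA : sign_assumption (fun t : tree n => exch (S t)).
Implicit Types (s t : tree n) (i j k : 'I_n) (a b : expo n).

Let B t := exch (S t).
Let x t i : F := cluster (S t) i.
Let c t i : trop n := coeffs (S t) i.

Lemma exch_sss t : sign_skew_symmetric (B t).
Proof. exact: (hB t [::]). Qed.

Lemma exch_diag t k : B t k k = 0.
Proof.
have [+ _] := exch_sss t k k; rewrite -expr2 => h; apply/eqP.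
by rewrite -sqrf_eq0 eq_le h sqr_ge0.
Qed.

Lemma exch_coherent : coherent_pattern B.
Proof.
have [pat _ _] := hS; case: hA => hA1 hA2; split.
- by move=> t k; rewrite /B pat.
- exact: exch_diag.
- exact: dual_coherentP.
exact: dual_coherentP.
Qed.

Lemma coeffs_C_mx t : coef_mx (coeffs (S t)) = C_mx B t0 t.
Proof.
have [pat init _] := hS; symmetry.
by apply: (C_mxE (Y := fun t => coeffs (S t))) => // u k; rewrite pat.
Qed.

Lemma c_nbr t k i d : c (nbr k t) i d 0 = if i == k then - c t k d 0
  else c t i d 0 + c t k d 0 * posp (B t k i) - Num.min (c t k d 0) 0 * B t k i.
Proof. by have [pat _ _] := hS; rewrite /c pat /= mu_coefE. Qed.

Lemma y_neq0 i : y i != 0.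
Proof.
have [_ _ /(free_generators_neq0 (rshift n i))] := hS.
by rewrite /join_vars (unsplitK (inr i : 'I_n + 'I_n)).
Qed.

Let chi t := chart y (x t).

(* [yhat t k] is the exponent of the variable y-hat in the chart at t, and
   [xmon t k e] is the exponent of the monomial that is left when the exchange
   polynomial at t in direction k is written as (1 + yhat^e) times a monomial. *)
Definition yhat t k : expo n := (col k (B t), c t k).
Definition xmon t k (e : int) : expo n :=
  (\col_i posp (- (e * B t i k)) - delta_mx k 0,
   (if e == 1 then 0 else c t k) - oplus (c t k) 0).
Definition kill k a : expo n := (\col_i if i == k then 0 else a.1 i 0, a.2).

Lemma xmonB t k : xmon t k (-1) = yhat t k + xmon t k 1.
Proof.
congr (_, _); apply/matrixP => i j; rewrite ord1 !mxE /=.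
  by rewrite mul1r mulN1r opprK addrA; congr (_ - _); have := posp_sub (B t i k); lia.
lia.
Qed.

Lemma x_neq0_t0 i : x t0 i != 0.
Proof.
have [_ _ /(free_generators_neq0 (lshift n i))] := hS.
by rewrite /join_vars (unsplitK (inl i : 'I_n + 'I_n)).
Qed.

Lemma chi_x t i : x t i = chi t (delta_mx i 0, 0).
Proof.
rewrite /chi /chart /trop_eval (bigD1 i) //= !mxE !eqxx expr1z !big1 ?mulr1 //.
  by move=> j _; rewrite mxE expr0z.
by move=> j ji; rewrite mxE (negPf ji) expr0z.
Qed.

Lemma x_exchange t k : (forall i, x t i != 0) ->
  x (nbr k t) k = chi t (xmon t k 1) + chi t (xmon t k (-1)).
Proof.
move=> x0; have [pat _ _] := hS; have chiP := chart_character x0 y_neq0.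
have yE (d : trop n) : trop_eval y d = chi t (0, d).
  by rewrite /chi /chart big1 ?mul1r // => i _; rewrite mxE expr0z.
have xE (v : 'I_n -> int) : \prod_i x t i ^ v i = chi t (\col_i v i, 0).
  rewrite /chi /chart /trop_eval [X in _ * X]big1 ?mulr1 => [|i _]; last by rewrite mxE expr0z.
  by apply: eq_bigr => i _; rewrite mxE.
rewrite /x pat /= ffunE eqxx !xE -/(x t k) chi_x !yE.
have [_ cD] := chiP; rewrite -!cD mulrDl -(chiN chiP) -!cD addrC.
congr (chi t _ + chi t _); congr (_, _); apply/matrixP => i j; rewrite ord1 !mxE /=;
  rewrite ?mul1r ?mulN1r ?opprK ?addr0 ?add0r //.
Qed.

Lemma x_other t k i : i != k -> x (nbr k t) i = x t i.
Proof. by move=> ik; have [pat _ _] := hS; rewrite /x pat ffunE (negPf ik). Qed.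

Lemma chart_nbr t k a : chi (nbr k t) a = chi t (kill k a) * x (nbr k t) k ^ a.1 k 0.
Proof.
rewrite /chi /chart /= mulrAC; congr (_ * _).
rewrite (bigD1 k) //= mulrC; congr (_ * _).
rewrite [RHS](bigD1 k) //= mxE eqxx expr0z mul1r; apply: eq_bigr => i ik.
by rewrite mxE (negPf ik) x_other.
Qed.

(* The weights with all y-hat at t0 negative see only one monomial of each
   exchange polynomial, by sign-coherence. *)
Lemma tropval_cone v w : (forall j, ((B t0)^T *m v + w) j 0 < 0) ->
  forall t, (forall i, x t i != 0) /\
   exists V, C_mx (dual_pattern B) t0 t *m V = v /\
     forall a, tropval (chi t0) (wt v w) (chi t a) (wt V w a).
Proof.
move=> neg; have coh := exch_coherent; have cohD := coherent_dual_pattern coh.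
have [_ _ free] := hS; have ind0 := chart_independent free.
have chiP0 := chart_character x_neq0_t0 y_neq0.
have wwt := wt_weight v w.
apply: (tree_walk_ind (s := t0)) => [|t k [x0 [V [CV vV]]]].
  split; first exact: x_neq0_t0.
  by exists v; rewrite C_mx_id mul1mx; split=> // a; apply: tropval_chi.
have [e eE] : {e | e = csgn (C_mx B t0 t) k} by eexists.
have ee : e = 1 \/ e = -1 by rewrite eE; apply: csgn_cases.
have cE i : c t k i 0 = C_mx B t0 t i k by rewrite -coeffs_C_mx mxE.
have [cnz csg] := coherent_signs t0 t coh k; rewrite -eE in csg.
(* By [exchange_C_mx] the weights of the y-hat at [t] form [C^T (B_0^T v + w)]; the bracket is
   negative and column [k] of [C] is nonzero of sign [e]. *)
have hat_neg : e * wt V w (yhat t k) < 0.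
  have -> : wt V w (yhat t k) = ((C_mx B t0 t)^T *m ((B t0)^T *m v + w)) k 0.
    rewrite mulmxDr -CV.
    have -> : (C_mx B t0 t)^T *m ((B t0)^T *m (C_mx (dual_pattern B) t0 t *m V)) = (B t)^T *m V.
      by rewrite (exchange_C_mx t0 t coh) !trmx_mul trmxK !mulmxA.
    rewrite mxE [X in X + _]mxE [X in _ + X]mxE /wt /=; congr (_ + _);
      apply: eq_bigr => i _; rewrite mulrC; first by rewrite !mxE.
    by rewrite cE [in RHS]mxE.
  move: (_ + w) neg => om neg; rewrite [X in e * X]mxE mulr_sumr.
  have /matrix0Pn[j [z]] := cnz; rewrite ord1 mxE => Cj.
  have omE i : (C_mx B t0 t)^T k i = C_mx B t0 t i k by rewrite mxE.
  rewrite (bigD1 j) //= ltr_wnDr //.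
    by apply: sumr_le0 => i _; rewrite mulrA omE mulr_ge0_le0 // ltW.
  rewrite mulrA omE pmulr_rlt0 // lt_neqAle csg andbT eq_sym mulf_neq0 //.
  by case: ee => ->.
pose V' := elem_mx k e (dual_pattern B t) *m V.
have vk : tropval (chi t0) (wt v w) (x (nbr k t) k) (V' k 0).
  rewrite x_exchange //.
  suff -> : V' k 0 = Num.max (wt V w (xmon t k 1)) (wt V w (xmon t k (-1))).
    by apply: tropval_add.
  have wB : wt V w (xmon t k (-1)) = wt V w (yhat t k) + wt V w (xmon t k 1).
    by rewrite xmonB wt_weight.
  have -> : Num.max (wt V w (xmon t k 1)) (wt V w (xmon t k (-1))) = wt V w (xmon t k e).
    by case: ee hat_neg wB => ->; move: (wt V w (xmon t k (-1))) (wt V w (xmon t k 1)); lia.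
  (* The tropical denominator exactly cancels the coefficient of the dominant monomial. *)
  have sec0 : (xmon t k e).2 = 0.
    apply/matrixP => i z; rewrite ord1 !mxE; have := csg i; rewrite -cE.
    by case: ee => -> /=; rewrite ?mxE; move: (c t k i 0); lia.
  rewrite /wt sec0 [X in _ = _ + X]big1 ?addr0 => [|i _]; last by rewrite mxE mulr0.
  rewrite /V' mul_elem_mxl eqxx [RHS](bigD1 k) //= !mxE exch_diag mulr0 oppr0 !eqxx.
  rewrite /posp maxxx sub0r mulrN1; congr (_ + _); apply: eq_bigr => i ik.
  by rewrite !mxE (negPf ik) subr0 mulrC mulrN.
split.
  move=> i; have [->|ik] := eqVneq i k; first exact: (tropval_neq0 ind0 vk).
  by rewrite x_other.
exists V'; split.
  by rewrite coherent_nbr // csgn_dual // -eE mulmxA -(mulmxA (C_mx _ _ _)) elem_mxK mulmx1.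
move=> a; rewrite chart_nbr.
have -> : wt V' w a = wt V w (kill k a) + V' k 0 * a.1 k 0.
  rewrite /wt /= addrAC; congr (_ + _); rewrite addrC (bigD1 k) //=; congr (_ + _).
  rewrite [RHS](bigD1 k) //= mxE eqxx mulr0 add0r; apply: eq_bigr => i ik.
  by rewrite /V' mul_elem_mxl (negPf ik) mxE (negPf ik).
by apply: tropval_mul => //; apply: tropval_exp.
Qed.

(** * Generic weights of the cone and independence in every chart *)

Definition cone_weight (v w : 'cV[int]_n) := forall j, ((B t0)^T *m v + w) j 0 < 0.

Lemma wt_dot (v w : 'cV[int]_n) a : wt v w a = (v^T *m a.1) 0 0 + (w^T *m a.2) 0 0.
Proof. by rewrite /wt !mxE; congr (_ + _); apply: eq_bigr => i _; rewrite mxE. Qed.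

(** The weights of the [x_t] are an invertible linear image of those of the [x_t0], so genericity at
    [t] is genericity at [t0] for transformed exponents. *)
Lemma generic_cone t (r : seq (expo n)) : exists v w, cone_weight v w /\
  forall V, C_mx (dual_pattern B) t0 t *m V = v ->
    forall a, a \in r -> a != 0 -> wt V w a != 0.
Proof.
have cohD := coherent_dual_pattern exch_coherent.
set C := C_mx _ _ _; pose D := C_mx (opp_pattern (dual_pattern B)) t t0.
have CD : C *m D = 1%:M by apply: C_mxV.
pose tr a : expo n := (D^T *m a.1, a.2).
have [v [w [neg gen]]] := generic_weight (B t0) [seq tr a | a <- r].
exists v, w; split=> // V CV a ar a0.
have -> : wt V w a = wt v w (tr a).
  have -> : V = D *m v by rewrite -CV mulmxA (mulmx1C CD) mul1mx.
  by rewrite !wt_dot trmx_mul mulmxA.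
apply: gen; first exact: map_f.
apply: contraNneq a0 => -[Da1 a2]; apply/eqP; case: a Da1 a2 {ar} => a1 a2 /= Da1 ->.
congr (_, _); have <- : C^T *m (D^T *m a1) = a1.
  by rewrite mulmxA -trmx_mul (mulmx1C CD) trmx1 mul1mx.
by rewrite Da1 mulmx0.
Qed.

Lemma x_neq0 t i : x t i != 0.
Proof.
have [v [w [neg _]]] := generic_cone t [::].
by have [] := tropval_cone neg t.
Qed.

Let chiP t : character (chi t) := chart_character (x_neq0 t) y_neq0.

Lemma chi0_independent : independent (chi t0).
Proof. by have [_ _] := hS; apply: chart_independent. Qed.

(** A weight that is nonzero on the differences of finitely many exponents is injective on them. *)
Lemma chi_independent t : independent (chi t).
Proof.
apply: (independent_transfer (chiP t0) chi0_independent) => r.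
have [v [w [neg gen]]] := generic_cone t [seq a - b | a <- r, b <- r].
have [_ [V [CV vV]]] := tropval_cone neg t.
exists (wt v w), (wt V w); split=> //; first exact: wt_weight.
move=> a b ar br eq_ab; apply/eqP; rewrite -subr_eq0; apply: contraT => ab0.
have abr : a - b \in [seq a - b | a <- r, b <- r] by apply/allpairsP; exists (a, b).
case/eqP: (gen V CV _ abr ab0).
by rewrite wt_weight weightN ?eq_ab ?subrr //; apply: wt_weight.
Qed.

Lemma tropval_chart s t lam : weight lam -> exists lam' : expo n -> int,
  weight lam' /\ forall a, tropval (chi s) lam (chi t a) (lam' a).
Proof.
move=> wlam; have ind := chi_independent (t := s).
move: t; apply: (tree_walk_ind (s := s)) => [|t k [lam' [wlam' vlam']]].
  by exists lam; split=> // a; apply: tropval_chi.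
pose m := Num.max (lam' (xmon t k 1)) (lam' (xmon t k (-1))).
have vk : tropval (chi s) lam (x (nbr k t) k) m.
  by rewrite (x_exchange k (x_neq0 t)); apply: tropval_add.
exists (fun a => lam' (kill k a) + m * a.1 k 0); split=> [a b|a].
  have -> : kill k (a + b) = kill k a + kill k b.
    congr (_, _); apply/matrixP => i z; rewrite !mxE.
    by case: ifP => _; rewrite ?addr0.
  by rewrite wlam' mxE mulrDr addrACA.
by rewrite chart_nbr; apply: tropval_mul => //; apply: tropval_exp.
Qed.

(** * The Laurent phenomenon *)

Lemma x_exchange_sign t k e : e = 1 \/ e = -1 ->
  x (nbr k t) k = (1 + chi t (yhat t k *~ e)) * chi t (xmon t k e).
Proof.
have [_ cD] := chiP t; rewrite (x_exchange k (x_neq0 t)) mulrDl mul1r -cD.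
case=> ->; first by rewrite mulr1z -xmonB.
by rewrite addrC mulrN1z xmonB addKr.
Qed.

(** The general rule has a further factor, [yhat t k] to the power [e * [e * B t k i]_+]; the sign
    hypothesis makes it trivial. *)
Lemma yhat_nbr t k i e : e = 1 \/ e = -1 -> i != k -> e * B t k i <= 0 ->
  chi (nbr k t) (yhat (nbr k t) i) =
    chi t (yhat t i) * (1 + chi t (yhat t k *~ e)) ^ (- B t k i).
Proof.
move=> ee ik sg; rewrite chart_nbr (x_exchange_sign t k ee) expfzMl.
have [pat _ _] := hS; have [_ cD] := chiP t.
have BE j l : B (nbr k t) j l = mu_mx k (B t) j l by rewrite /B pat.
have -> : (yhat (nbr k t) i).1 k 0 = - B t k i by rewrite mxE BE mu_mx_row.
rewrite -(chiMz (chiP t)) mulrCA -cD mulrC; congr (chi t _ * _).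
rewrite /yhat /kill /xmon -scaler_int; congr (_, _); apply/matrixP => j z;
  rewrite ord1 !mxE intz /=.
  rewrite BE !mxE; case: (eqVneq j k) => [->|jk] /=.
    by rewrite exch_diag; case: ee => -> ; rewrite ?mulr0 /posp; lia.
  rewrite (negPf ik) subr0 /posp.
  by case: ee sg => ->; case: (sgrP (B t j k)); nia.
rewrite c_nbr (negPf ik).
by case: ee sg => -> /=; rewrite /posp ?mxE; nia.
Qed.

Lemma yhat_nbr_self t k :
  chi (nbr k t) (yhat (nbr k t) k) = (chi t (yhat t k))^-1.
Proof.
have [pat _ _] := hS.
have BE j l : B (nbr k t) j l = mu_mx k (B t) j l by rewrite /B pat.
rewrite chart_nbr mxE BE mu_mx_row exch_diag oppr0 expr0z mulr1 -(chiN (chiP t)).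
congr (chi t _); congr (_, _); apply/matrixP => j z; rewrite ord1 !mxE.
  by case: eqP => [->|_]; rewrite ?exch_diag ?oppr0 // BE mu_mx_col.
by rewrite c_nbr eqxx.
Qed.

Lemma away_chart s t Y : laurent (chi s) Y ->
  (forall i, laurent_away (chi s) Y (x t i) /\ laurent_away (chi s) Y (x t i)^-1) ->
  forall f, laurent (chi t) f -> laurent_away (chi s) Y f.
Proof.
move=> lY ax f; apply: (away_ev (chiP s) lY) => a; apply: (away_mul (chiP s)).
  by apply: (away_prod (chiP s)) => i; have [] := ax i; apply: (away_exp (chiP s)).
apply: (@away_laurent _ _ (chi s)).
have -> : trop_eval y a.2 = chi s (0, a.2); last exact: laurent_chi.
by rewrite /chi /chart big1 ?mul1r // => i _; rewrite mxE expr0z.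
Qed.

Lemma away_x s i Y : laurent_away (chi s) Y (x s i) /\ laurent_away (chi s) Y (x s i)^-1.
Proof.
rewrite chi_x -(chiN (chiP s)); split; apply: (@away_laurent _ _ (chi s)); exact: laurent_chi.
Qed.

(** The C-matrix is invertible, so [e] times row [j] of its inverse, used as a weight on the [y]
    alone, gives [yhat s j *~ e] degree 1 and [yhat s k *~ e] degree 0, as [grade_cancel]
    requires. *)
Lemma regular_mod_yhat s k j e (z : int) : e = 1 \/ e = -1 -> j != k ->
  regular_mod (chi s) (1 + chi s (yhat s k *~ e)) (1 + z%:~R * chi s (yhat s j *~ e)).
Proof.
move=> ee jk f g [l ->] lg.
pose D := C_mx (opp_pattern B) s t0.
have DC : D *m C_mx B t0 s = 1%:M by apply: mulmx1C; apply: C_mxV exch_coherent.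
pose w : 'cV[int]_n := \col_i (e * D j i).
have lamE i : wt 0 w (yhat s i *~ e) = (j == i)%:R.
  have := congr1 (fun A : 'M_n => A j i) DC; rewrite mxE [RHS]mxE => <-.
  rewrite /wt big1 ?add0r => [|h _]; last by rewrite mxE mul0r.
  apply: eq_bigr => h _.
  have -> : C_mx B t0 s h i = c s i h 0 by rewrite -coeffs_C_mx mxE.
  have -> : (yhat s i *~ e).2 h 0 = e * c s i h 0 by rewrite -scaler_int [LHS]mxE intz.
  have -> : w h 0 = e * D j h by rewrite [LHS]mxE.
  by case: ee => ->; ring.
apply: (grade_cancel (chiP s) (lam := wt 0 w) (chi_independent (t := s)) (wt_weight _ _)) lg.
  by rewrite lamE (negPf jk).
by rewrite lamE eqxx.
Qed.

(* Modulo X = 1 + yhat_k^e, the two new variables x_j and x_k on the path k, j, k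
   become, up to monomials, 1 + z v with v = yhat_j^e: they are prime to X. *)
Lemma laurent_step s k j f : j != k ->
  laurent (chi (nbr k s)) f -> laurent (chi (nbr k (nbr j (nbr k s)))) f ->
  laurent (chi s) f.
Proof.
move=> jk; set s1 := nbr k s; set s2 := nbr j s1; set s3 := nbr k s2 => lf1 lf3.
have kj : k != j by rewrite eq_sym.
have coh := exch_coherent.
have [_ cD] := chiP s.
(* This sign meets the hypothesis of [yhat_nbr] for the mutation at [k] and for the next one at
   [j]. *)
have [e [ee [m [p [Bkj [Bjk mp]]]]]] : exists e : int, (e = 1 \/ e = -1) /\
    exists m p : nat, B s k j = - (e * m%:Z) /\ B s j k = e * p%:Z /\ (m = 0 -> p = 0)%N.
  have [sg zz] := exch_sss s j k; have [_ zz'] := exch_sss s k j.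
  have [le|lt] := leP 0 (B s j k).
    exists 1; split; [by left|exists (absz (B s k j)), (absz (B s j k))]; nia.
  exists (-1); split; [by right|exists (absz (B s k j)), (absz (B s j k))]; nia.
have B1 h i : B s1 h i = mu_mx k (B s) h i by rewrite /s1 (coherent_exchange coh).
have B2 h i : B s2 h i = mu_mx j (B s1) h i by rewrite /s2 (coherent_exchange coh).
set u := chi s (yhat s k *~ e); set v := chi s (yhat s j *~ e).
pose X := 1 + u; pose W := 1 + v * X ^+ m.
have lu : laurent (chi s) u by apply: laurent_chi.
have lv : laurent (chi s) v by apply: laurent_chi.
have lX : laurent (chi s) X by apply: laurent_add => //; apply: laurent1 (chiP s).
have xk1 : x s1 k = X * chi s (xmon s k e) by apply: x_exchange_sign.
have X0 : X != 0.
  by apply: contraNneq (x_neq0 s1 k) => X0; rewrite xk1 X0 mul0r.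
have expE (g : F) (q : nat) : g != 0 -> (g ^ (e * q%:Z)) ^ e = g ^+ q.
  move=> g0; rewrite exprz_exp; have -> : e * q%:Z * e = q%:Z by case: ee => ->; ring.
  by [].
have hat1 : chi s1 (yhat s1 j *~ e) = v * X ^+ m.
  rewrite (chiMz (chiP s1)) (yhat_nbr ee jk); last by rewrite Bkj; case: ee => ->; lia.
  by rewrite -/u -/X Bkj opprK expfzMl -(chiMz (chiP s)) expE.
have [a1 xj2] : exists a, x s2 j = W * chi s a.
  exists (kill k (xmon s1 j e)); rewrite (x_exchange_sign s1 j ee) hat1 chart_nbr.
  rewrite [(xmon s1 j e).1 k 0](_ : _ = 0) ?expr0z ?mulr1 //.
  by rewrite !mxE B1 mu_mx_row (negPf kj) Bkj /posp; case: ee => ->; lia.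
have W0 : W != 0.
  by apply: contraNneq (x_neq0 s2 j) => W0; rewrite xj2 W0 mul0r.
have hat2 : chi s2 (yhat s2 k *~ e) = u^-1 * W ^+ p.
  rewrite (chiMz (chiP s2)) (yhat_nbr ee kj); last first.
    by rewrite B1 mu_mx_col Bjk; case: ee => ->; lia.
  rewrite hat1 -/W B1 mu_mx_col opprK Bjk expfzMl expE // yhat_nbr_self.
  by rewrite exprz_inv /u (chiMz (chiP s)) invr_expz.
have [z1 [r1 [lr1 WE]]] : exists (z : int) r, laurent (chi s) r /\
    W = 1 + z%:~R * v + X * r.
  rewrite /W; case: (m) => [|q].
    exists 1, 0; split; first exact: (laurent_int (chiP s) 0).
    by rewrite mulr0 addr0 mulr1 mul1r.
  exists 0, (v * X ^+ q); split.
    by apply: laurent_mul => //; apply: laurent_exp.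
  by rewrite exprS mul0r addr0 mulrCA.
(* [W ^+ p] is 1 modulo [X] in all cases, because [m = 0] forces [p = 0]; its first-order term is an
   integer multiple of [v]. *)
have [z2 [r2 [lr2 WpE]]] : exists (z : int) r, laurent (chi s) r /\
    W ^+ p = 1 + X * (z%:~R * v + X * r).
  have l0 : laurent (chi s) 0 := laurent_int (chiP s) 0.
  have [p0|[z [r [lr WE']]]] : p = 0%N \/ exists (z : int) r, laurent (chi s) r /\
      W = 1 + X * (z%:~R * v + X * r).
  - rewrite /W; case: (m) mp => [/(_ erefl)|[|q] _]; [by left|right|right].
      by exists 1, 0; split=> //; ring.
    exists 0, (v * X ^+ q); split; last by rewrite !exprS; ring.
    by apply: laurent_mul => //; apply: laurent_exp.
  - by exists 0, 0; rewrite p0; split=> //; ring.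
  elim: (p) => [|q [z' [r' [lr' IH]]]]; first by exists 0, 0; split=> //; ring.
  exists (z + z'), (r + r' + (z%:~R * v + X * r) * (z'%:~R * v + X * r')).
  split; last by rewrite exprS IH {1}WE' intrD; ring.
  have lz (h : int) g : laurent (chi s) g -> laurent (chi s) (h%:~R * v + X * g).
    move=> lg; apply: laurent_add; apply: laurent_mul => //; exact: laurent_int.
  by apply: laurent_add; [apply: laurent_add|apply: laurent_mul => //; apply: lz].
(* [X] divides [u + W ^+ p], which cancels the factor [X] of [x s1 k] in the denominator. *)
have [a3 xk3] : exists a, x s3 k = (1 + z2%:~R * v + X * r2) * chi s a.
  rewrite (x_exchange_sign s2 k ee) hat2 chart_nbr.
  rewrite [(xmon s2 k e).1 j 0](_ : _ = 0) ?expr0z ?mulr1; last first.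
    by rewrite !mxE B2 mu_mx_row B1 mu_mx_col (negPf jk) Bjk /posp; case: ee => ->; lia.
  rewrite chart_nbr -/s1; set a2 := kill k _.
  rewrite [(kill j _).1 k 0](_ : _ = -1); last first.
    by rewrite !mxE (negPf kj) exch_diag mulr0 oppr0 /posp maxxx !eqxx.
  exists (- (yhat s k *~ e) + (a2 - xmon s k e)); rewrite !cD !(chiN (chiP s)) -/u exprN1 xk1.
  have u0 : u != 0 by apply: chi_neq0 (chiP s) _.
  have xm0 : chi s (xmon s k e) != 0 by apply: chi_neq0 (chiP s) _.
  by rewrite WpE /X; field; rewrite xm0 X0 u0.
have reg h := @regular_mod_yhat s k j e h ee jk.
pose Y := x s2 j * x s3 k.
have l1 : laurent (chi s) 1 := laurent1 (chiP s).
have lzv (h : int) : laurent (chi s) (1 + h%:~R * v).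
  apply: laurent_add l1 _; apply: laurent_mul lv => //; exact: laurent_int (chiP s) _.
have lx2 : laurent (chi s) (x s2 j).
  rewrite xj2 WE; apply: laurent_mul => //; last exact: laurent_chi.
  by apply: laurent_add => //; apply: laurent_mul.
have lx3 : laurent (chi s) (x s3 k).
  rewrite xk3; apply: laurent_mul => //; last exact: laurent_chi.
  by apply: laurent_add => //; apply: laurent_mul.
have lY : laurent (chi s) Y by apply: laurent_mul.
have regY : regular_mod (chi s) X Y.
  apply: regular_mod_mul => //.
    rewrite xj2 WE; apply: regular_mod_mul; [done|exact: laurent_chi| |exact: regular_mod_chi].
    by apply: regular_mod_shift => //; apply: reg.
  rewrite xk3; apply: regular_mod_mul; [done|exact: laurent_chi| |exact: regular_mod_chi].
  by apply: regular_mod_shift => //; apply: reg.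
have other3 i : i != k -> i != j -> x s3 i = x s i.
  by move=> ik ij; rewrite !x_other.
(* Over the chart at [s], being Laurent at [s3] leaves only powers of [Y] as denominators, and being
   Laurent at [s1] only powers of [X]. *)
have [m3 lm3] : laurent_away (chi s) Y f.
  apply: away_chart lf3 => // i; have [->|ik] := eqVneq i k.
    split; first exact: away_laurent.
    by exists 1%N; rewrite expr1 mulrCA mulVf ?mulr1 ?x_neq0.
  have [->|ij] := eqVneq i j; last by rewrite other3 //; apply: away_x.
  rewrite x_other // -/s2; split; first exact: away_laurent.
  by exists 1%N; rewrite expr1 mulrA mulVf ?mul1r ?x_neq0.
have lx1 : laurent (chi s) (x s1 k).
  by rewrite xk1; apply: laurent_mul => //; apply: laurent_chi.
have [m1 lm1] : laurent_away (chi s) (x s1 k) f.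
  apply: away_chart lf1 => // i; have [->|ik] := eqVneq i k.
    split; first exact: away_laurent.
    by exists 1%N; rewrite expr1 mulVf ?x_neq0.
  by rewrite (x_other s ik); apply: away_x.
apply: (regular_mod_cancel (chiP s) X0 lX (Y := Y ^+ m3) (m := m1)) => //.
- exact: laurent_exp.
- exact: regular_mod_exp.
move: lm1; rewrite xk1 exprMn mulrA => lm1.
have -> : f * X ^+ m1 = f * X ^+ m1 * chi s (xmon s k e) ^+ m1 * chi s (- xmon s k e) ^+ m1.
  by rewrite (chiN (chiP s)) exprVn mulfK // expf_neq0 ?chi_neq0.
by apply: laurent_mul => //; apply: laurent_exp => //; apply: laurent_chi.
Qed.

(** A path [k, j, ks] is traded for two paths one edge shorter: [j, ks] from [nbr k s], and [k, ks]
    from the far end of the path [k, j, k], whose first edge leads back to the original path. *)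
Lemma laurent_phenomenon s t i : laurent (chi s) (x t i).
Proof.
rewrite -(walk_geodesic s t); move: (geodesic s t) => ks {t}.
have [d] := ubnP (size ks); elim: d ks s => // d IH [|k [|j ks]] s szd.
- by rewrite /= chi_x; apply: laurent_chi.
- rewrite /=; have [->|ik] := eqVneq i k; last by rewrite x_other // chi_x; apply: laurent_chi.
  rewrite x_exchange; last exact: x_neq0.
  by apply: laurent_add => //; apply: laurent_chi.
have [->|jk] := eqVneq j k; first by rewrite /= nbrK; apply: IH; rewrite /= in szd; lia.
apply: (laurent_step jk); first by apply: (IH (j :: ks)).
have := IH (k :: ks) (nbr k (nbr j (nbr k s))); rewrite /= nbrK; exact.
Qed.

(** * Comparison of two clusters with the same dual C-matrix *)

Section Equality.
Variables (t t' : tree n).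
Hypothesis eqD : C_mx (dual_pattern B) t0 t = C_mx (dual_pattern B) t0 t'.

Lemma ratio_val s i lam : weight lam -> exists d, tropval (chi s) lam (x t' i / x t i) d.
Proof.
move=> wlam; have [lam' [_ v1]] := tropval_chart s t wlam.
have [lam'' [_ v2]] := tropval_chart s t' wlam.
exists (lam'' (delta_mx i 0, 0) - lam' (delta_mx i 0, 0)).
rewrite !chi_x; apply: (tropval_mul (chiP s)) => //; exact: tropval_inv.
Qed.

(* In a generic weight of the cone, x_{i;t} and x_{i;t'} have the same value,
   and 0 is the only exponent of value 0. *)
Lemma ratio_coef0 i l : x t' i / x t i = ev (chi t) l -> coef l 0 != 0.
Proof.
move=> eq_l; have [v [w [neg gen]]] := generic_cone t (unzip2 l).
have [_ [V [CV vV]]] := tropval_cone neg t; have [_ [V' [CV' vV']]] := tropval_cone neg t'.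
have VV' : V' = V.
  have := C_mxV t0 t (coherent_dual_pattern exch_coherent) => /mulmx1C DC.
  by rewrite -[LHS]mul1mx -[RHS]mul1mx -DC -!mulmxA CV eqD CV'.
have wv := wt_weight v w.
have v0 : tropval (chi t0) (wt v w) (x t' i / x t i) 0.
  rewrite -(subrr (wt V w (delta_mx i 0, 0))) !chi_x.
  by apply: (tropval_mul (chiP t0) wv); [rewrite -VV'|apply: tropval_inv].
have [d vd] := ratio_val t i (wt_weight V w).
have := tropval_transfer (chiP t0) chi0_independent wv vV vd.
move/(tropval_uniq (chiP t0) chi0_independent wv v0) => d0.
rewrite -d0 eq_l in vd.
have [_ [a al a0]] := tropval_laurent (chiP t) (chi_independent (t := t)) (wt_weight V w) vd.
have [<- //|an0] := eqVneq a 0.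
have ar : a \in unzip2 l by apply: contraNT al => /coef_notin ->.
by case/eqP: (gen V CV a ar an0).
Qed.

End Equality.

Lemma ratio_inv t t' i : x t i / x t' i = (x t' i / x t i)^-1.
Proof. by rewrite invf_div. Qed.

Lemma ratio_int t t' i : C_mx (dual_pattern B) t0 t = C_mx (dual_pattern B) t0 t' ->
  exists z : int, x t' i / x t i = z%:~R.
Proof.
move=> eqD; have lau s s' : laurent (chi s) (x s' i / x s i).
  apply: laurent_mul => //; first exact: laurent_phenomenon.
  by rewrite chi_x -(chiN (chiP s)); apply: laurent_chi.
have [l eq_l] := lau t t'; have [l' eq_l'] := lau t' t.
have l'0 := ratio_coef0 (esym eqD) eq_l'.
exists (coef l 0); rewrite eq_l; apply/eqP; rewrite -subr_eq0; apply/eqP.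
have -> : ev (chi t) l - (coef l 0)%:~R = ev (chi t) (l ++ [:: (- coef l 0, 0)]).
  by rewrite ev_cat ev_cons ev_nil addr0 (chiP t).1 mulr1 mulrNz.
apply: ev_eq0 => a; rewrite coef_cat {2}/coef big_cons big_nil /=.
have [<-|a0] := eqVneq 0 a; first by rewrite addr0 subrr.
rewrite addr0; apply/eqP; apply: contraT => al; case/eqP: a0.
(* Each exponent [a] is tested with itself as weight: its weight is the squared length of [a],
   bounded by the value [d] of the ratio. The constant term of the inverse gives [- d >= 0], so
   [a = 0]. *)
have [d vd] := ratio_val t t' t i (wt_weight a.1 a.2).
have [lam' [wlam' vlam']] := tropval_chart t t' (wt_weight a.1 a.2).
have ind s : independent (chi s) := chi_independent (t := s).
have [d' vd'] := ratio_val t' t t' i wlam'.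
have d'E : d' = - d.
  apply: (tropval_uniq (chiP t) (ind t) (wt_weight a.1 a.2)).
    exact: (tropval_transfer (chiP t) (ind t) (wt_weight a.1 a.2) vlam' vd').
  by rewrite ratio_inv; apply: tropval_inv.
rewrite eq_l in vd; rewrite eq_l' in vd'.
have [le_d _] := tropval_laurent (chiP t) (ind t) (wt_weight a.1 a.2) vd.
have [le_d' _] := tropval_laurent (chiP t') (ind t') wlam' vd'.
have := le_d' _ l'0; rewrite weight0 // d'E oppr_ge0 => d_le0.
have := le_trans (le_d _ al) d_le0; rewrite /wt.
have sq_ge0 (u : 'cV[int]_n) : 0 <= \sum_i u i 0 * u i 0.
  by apply: sumr_ge0 => j _; rewrite -expr2 sqr_ge0.
have sq_eq0 (u : 'cV[int]_n) : \sum_i u i 0 * u i 0 = 0 -> u = 0.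
  move=> /eqP; rewrite psumr_eq0 => [/allP h|j _]; last by rewrite -expr2 sqr_ge0.
  apply/matrixP => j z; rewrite ord1 mxE; apply/eqP.
  by have := h j (mem_index_enum _); rewrite -expr2 sqrf_eq0.
have add_eq0 (p q : int) : 0 <= p -> 0 <= q -> p + q <= 0 -> p = 0 /\ q = 0 by lia.
case/(add_eq0 _ _ (sq_ge0 _) (sq_ge0 _)) => /sq_eq0 + /sq_eq0.
by case: (a) => a1 a2 /= -> ->.
Qed.

Lemma cluster_eq t t' i : C_mx (dual_pattern B) t0 t = C_mx (dual_pattern B) t0 t' ->
  x t i = x t' i.
Proof.
move=> eqD; have [z zE] := ratio_int i eqD; have [z' zE'] := ratio_int i (esym eqD).
suff z1 : z = 1 by apply/esym; rewrite -[LHS](divfK (x_neq0 t i)) zE z1 mul1r.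
have zz : z * z' = 1.
  have : ev (chi t) [:: (z * z' - 1, 0)] = 0.
    rewrite ev_cons ev_nil addr0 (chiP t).1 mulr1 intrB intrM -zE -zE'.
    by rewrite (ratio_inv t t') divff ?subrr // mulf_neq0 ?invr_neq0 ?x_neq0.
  move/(chi_independent (t := t))/(_ 0); rewrite /coef big_cons big_nil eqxx addr0 /=.
  by move/eqP; rewrite subr_eq0 => /eqP.
have /orP[/eqP //|/eqP zN1] : (z == 1) || (z == -1).
  by apply: (intUnitRing.unitzPl (n := z')); rewrite mulrC.
(* Excludes -1: having a value, [1 + x t' i / x t i] is nonzero; any weight would do, and zero is
   taken. *)
have w0 := wt_weight (0 : 'cV[int]_n) 0.
have [d vd] := ratio_val t t' t i w0.
have := tropval_neq0 (chi_independent (t := t))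
  (tropval_add (chiP t) (chi_independent (t := t)) w0 vd (tropval1 (chiP t) w0)).
by rewrite zE zN1 mulrNz addNr eqxx.
Qed.

End Pattern.

Theorem theorem5p10 (F : fieldType) (n : nat) (y : 'I_n -> F)
    (t0 : tree n) (S : tree n -> seed F n)
    (hS : principal_coefficients y t0 S)
    (hB : forall t : tree n, totally_sign_skew_symmetric (exch (S t)))
    (hA : sign_assumption (fun t : tree n => exch (S t)))
    (t t' : tree n)
    (hC : coef_mx (coeffs (S t)) = coef_mx (coeffs (S t'))) :
  S t = S t'.
Proof.
have coh := exch_coherent hS hB hA.
have eqC : C_mx (fun u => exch (S u)) t0 t = C_mx (fun u => exch (S u)) t0 t'.
  by rewrite -!(coeffs_C_mx hS).
have eqD := dual_C_mx_eq coh eqC.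
have eqx : cluster (S t) = cluster (S t').
  by apply/ffunP => i; apply: (cluster_eq hS hB hA i eqD).
have eqB : exch (S t) = exch (S t').
  rewrite (exchange_C_mx t0 t coh) (exchange_C_mx t0 t' coh).
  by rewrite eqC eqD.
have eqc : coeffs (S t) = coeffs (S t').
  apply/ffunP => i; apply/matrixP => j z; rewrite ord1.
  by have := congr1 (fun A : 'M_n => A j i) hC; rewrite !mxE.
by case: (S t) (S t') eqx eqB eqc => ? ? ? [? ? ?] /= -> -> ->.
Qed.
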